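(* Let $\Phi$ be an irreducible crystallographic root system of rank $n$ with Weyl group $W$ and affine Weyl group $\widetilde{W}=W\ltimes\mathbb{Z}\Phi^\vee$. Then the flag $h$-polynomial of the reduced Steinberg torus $\Sigma'_T(\widetilde{W})$ is the multivariate affine Eulerian polynomial: $$h(\Sigma'_T(\widetilde{W});t_0,\dots,t_n)=\widetilde{W}(t_0,\dots,t_n).$$ In particular, for all $J\subseteq\{0,1,\dots,n\}$, $$f_J(\Sigma'_T(\widetilde{W}))=|\{w\in W:\widetilde{\mathrm{Des}}(w)\subseteq J\}|,\qquad h_J(\Sigma'_T(\widetilde{W}))=|\{w\in W:\widetilde{\mathrm{Des}}(w)=J\}|.$$ Furthermore, $$\widetilde{W}(t_0,\dots,t_n)=\sum_{J\subsetneq\{0,1,\dots,n\}}\frac{|W|}{|W_J|}\prod_{j\in J}(1-t_j)\prod_{j\in\{0,\dots,n\}\setminus J}t_j,$$ where $W_J$ denotes the (not necessarily parabolic) subgroup of $W$ generated by $\{s_j:j\in J\}$.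
   Context: Setting: $\Phi$ is an irreducible crystallographic root system in a real Euclidean space $V$ with inner product $\langle\cdot,\cdot\rangle$; $\Delta=\{\alpha_1,\dots,\alpha_n\}$ is a fixed set of simple roots, assumed to span $V$; $s_1,\dots,s_n$ are the corresponding simple reflections, generating the finite Weyl group $W$. We write $\beta>0$ (resp. $\beta<0$) for positive (resp. negative) roots. $\widetilde\alpha$ is the highest root, $\alpha_0:=-\widetilde\alpha$, and $s_0:=s_{\widetilde\alpha}\in W$ is the (linear) reflection in $\widetilde\alpha$. Write $[0,n]=\{0,1,\dots,n\}$. $\mathbb{Z}\Phi^\vee$ is the lattice generated by the co-roots $\beta^\vee=2\beta/\langle\beta,\beta\rangle$, acting on $V$ by translations; $\widetilde W=W\ltimes\mathbb{Z}\Phi^\vee$. Affine descents: for $w\in W$, $\widetilde{\mathrm{Des}}(w):=\{j\in[0,n]:w\alpha_j<0\}$. The multivariate affine Eulerian polynomial is $\widetilde W(t_0,\dots,t_n):=\sum_{w\in W}\prod_{j\in\widetilde{\mathrm{Des}}(w)}t_j$. Affine Coxeter complex: the hyperplanes $H_{\beta,k}=\{\lambda\in V:\langle\lambda,\beta\rangle=k\}$ ($\beta\in\Phi$, $k\in\mathbb{Z}$) partition $V$ into the open cells of a simplicial complex $\Sigma(\widetilde W)$ (which also includes the empty face). For $J\subseteq[0,n]$ let $A_J$ be the face of the fundamental alcove consisting of all $\lambda\in V$ such that: $\langle\lambda,\alpha_j\rangle=0$ for $j\in J\setminus\{0\}$; $\langle\lambda,\alpha_j\rangle>0$ for $j\in\{1,\dots,n\}\setminus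 J$; and $\langle\lambda,\widetilde\alpha\rangle=1$ if $0\in J$, $\langle\lambda,\widetilde\alpha\rangle<1$ if $0\notin J$. ($A_\varnothing$ is the fundamental alcove; $A_{[0,n]}$ is the empty face.) Every cell has the form $\mu+wA_J$ with $\mu\in\mathbb{Z}\Phi^\vee$, $w\in W$, $J\subseteq[0,n]$. The vertices $\mu+wA_{[0,n]\setminus\{j\}}$ are given color $j$; then the vertices of $\mu+wA_J$ have color-set $[0,n]\setminus J$, without repetition. Steinberg torus: $\mathbb{Z}\Phi^\vee$ acts on $\Sigma(\widetilde W)$ by color-preserving automorphisms; the Steinberg torus is the quotient cell complex $\Sigma_T(\widetilde W)=\Sigma(\widetilde W)/\mathbb{Z}\Phi^\vee$ (a finite Boolean cell complex, whose cells inherit color-sets), and the reduced Steinberg torus $\Sigma'_T(\widetilde W)$ is obtained from it by deleting the empty cell of dimension $-1$. Flag $f$- and $h$-vectors: for such a finite colored complex $\Sigma$ with colors in $[0,n]$, $f_J(\Sigma)$ is the number of cells of $\Sigma$ with color-set $J$ (so $f_\varnothing(\Sigma'_T(\widetilde W))=0$), $h_J(\Sigma):=\sum_{I\subseteq J}(-1)^{|J\setminus I|}f_I(\Sigma)$, and the flag $h$-polynomial is $h(\Sigma;t_0,\dots,t_n):=\sum_{J\subseteq[0,n]}h_J(\Sigma)\prod_{j\in J}t_j$. *)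

(* Defs.v *)
From HB Require Import structures.
From mathcomp Require Import all_boot all_order all_algebra.
From mathcomp Require Import finmap boolp classical_sets functions cardinality fsbigop.
From mathcomp Require Import reals.
From mathcomp Require Export mpoly.

Set Implicit Arguments.
Unset Strict Implicit.
Unset Printing Implicit Defensive.

Import Order.TTheory GRing.Theory Num.Theory.

Local Open Scope classical_set_scope.
Local Open Scope ring_scope.

(* Meaningful only for finite A: the value is 0 when A is infinite. *)
Definition fincard (T : choiceType) (A : set T) : nat := #|` fset_set A|%fset.

(* The flag f- and h-vectors of a complex depend only on its set of cells and
   on their color-sets; the face relation is therefore not recorded. *)
Record colored_complex (n : nat) := ColoredComplex {
  cell_type : choiceType;
  cells : set cell_type;
  color_set : cell_type -> {set 'I_n.+1} }.

Section FlagVectors.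
Context (n : nat) (S : colored_complex n).
Implicit Types I J : {set 'I_n.+1}.

Definition flag_f J : nat :=
  fincard [set c : cell_type S | cells c /\ color_set c = J].

Definition flag_h J : int :=
  \sum_(I : {set 'I_n.+1} | I \subset J) (-1) ^+ #|J :\: I| * (flag_f I)%:Z.

Definition flag_h_poly : {mpoly rat[n.+1]} :=
  \sum_(J : {set 'I_n.+1}) (flag_h J)%:~R *: \prod_(j in J) 'X_j.

End FlagVectors.

Section RootSystem.
Context (R : realType) (V : vectType R) (dot : {dot V for idfun}).

Definition coroot (b : V) : V := (2 / dot b b) *: b.

Definition reflection_fun (b v : V) : V := v - dot v (coroot b) *: b.

Lemma reflection_fun_linear b : linear (reflection_fun b).
Proof.
move=> a u v; rewrite /reflection_fun linearDl linearZl_LR scalerDl scalerBr.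
by rewrite scalerA opprD addrACA.
Qed.

HB.instance Definition _ b :=
  GRing.isLinear.Build R V V _ (reflection_fun b) (reflection_fun_linear b).

Definition reflection (b : V) : 'End(V) := linfun (reflection_fun b).

(* Reduced root systems; that Phi spans V follows from [simple_roots]. *)
Record root_system (Phi : set V) : Prop := RootSystem {
  root_finite : finite_set Phi;
  root_neq0 : forall b, Phi b -> b != 0;
  root_reduced : forall b (c : R), Phi b -> Phi (c *: b) -> c = 1 \/ c = -1;
  root_reflection : forall a b, Phi a -> Phi b -> Phi (reflection a b);
  root_crystallographic :
    forall a b, Phi a -> Phi b -> dot b (coroot a) \is a Num.int }.

Definition irreducible_system (Phi : set V) : Prop :=
  Phi !=set0 /\
  forall A B : set V, Phi = A `|` B ->
    (forall a b, A a -> B b -> dot a b = 0) -> A = set0 \/ B = set0.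

(* Subgroup of GL(V) generated by a set of invertible linear maps. *)
Inductive generated_group (S : set 'End(V)) : 'End(V) -> Prop :=
| gen_id : generated_group S \1%VF
| gen_base s : S s -> generated_group S s
| gen_comp f g : generated_group S f -> generated_group S g ->
    generated_group S (f \o g)%VF
| gen_inv f : generated_group S f -> generated_group S (f^-1)%VF.

Section SimpleRoots.
Context (n : nat) (Phi : set V) (alpha : 'I_n -> V) (theta : V).
Implicit Types (J : {set 'I_n.+1}) (F : set V).

Definition nonneg_comb (v : V) : Prop :=
  exists c : 'I_n -> nat, v = \sum_i alpha i *+ c i.

Definition simple_roots : Prop :=
  [/\ forall i, Phi (alpha i),
      basis_of fullv [seq alpha i | i : 'I_n] &
      forall b, Phi b -> nonneg_comb b \/ nonneg_comb (- b)].

Definition neg_root (b : V) : Prop := Phi b /\ nonneg_comb (- b).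

Definition highest_root : Prop :=
  Phi theta /\ forall b, Phi b -> nonneg_comb (theta - b).

(* Indices 1..n of the simple roots are the [lift ord0 i], i : 'I_n;
   [ord0] is the index of the affine node. *)
Definition ext_root (j : 'I_n.+1) : V :=
  if unlift ord0 j is Some i then alpha i else - theta.

Definition ext_reflection (j : 'I_n.+1) : 'End(V) :=
  if unlift ord0 j is Some i then reflection (alpha i) else reflection theta.

Definition weyl_group : set 'End(V) :=
  generated_group [set s | exists i, s = reflection (alpha i)].

(* W_J: s_0 is the linear reflection in theta, so this is a subgroup of W. *)
Definition weyl_subgroup J : set 'End(V) :=
  generated_group [set s | exists2 j, j \in J & s = ext_reflection j].

Definition affine_descents (w : 'End(V)) : {set 'I_n.+1} :=
  [set j | `[< neg_root (w (ext_root j)) >]]%SET.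

Definition affine_eulerian : {mpoly rat[n.+1]} :=
  \sum_(w \in weyl_group) \prod_(j in affine_descents w) ('X_j : {mpoly rat[n.+1]}).

Definition coroot_lattice : set V :=
  [set mu | exists c : V -> int, mu = \sum_(b \in Phi) coroot b *~ c b].

(* The open cell of x in the arrangement of all hyperplanes <.,b> = k. *)
Definition open_cell (x : V) : set V :=
  [set y | forall b (k : int), Phi b ->
     Num.sg (dot y b - k%:~R) = Num.sg (dot x b - k%:~R)].

(* The cells of the affine Coxeter complex; set0 is the empty face. *)
Definition coxeter_cell F : Prop := F = set0 \/ exists x, F = open_cell x.

Definition alcove_face J : set V :=
  [set x | (forall i, if lift ord0 i \in J then dot x (alpha i) = 0
                      else 0 < dot x (alpha i)) /\
           (if ord0 \in J then dot x theta = 1 else dot x theta < 1)].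

Definition colored_vertex (j : 'I_n.+1) : set (set V) :=
  [set v | exists mu w, [/\ coroot_lattice mu, weyl_group w &
     v = [set mu + w x | x in alcove_face (~: [set j])%SET]]].

(* Topological closure for the Euclidean norm. *)
Definition euclidean_closure F : set V :=
  [set x | forall e : R, 0 < e -> exists2 y, F y & dot (x - y) (x - y) < e].

(* The vertices of a cell are those lying in its closure. *)
Definition cell_colors F : {set 'I_n.+1} :=
  [set j | `[< exists2 v, colored_vertex j v & v `<=` euclidean_closure F >]]%SET.

Definition lattice_orbit F : set (set V) :=
  [set G | exists2 mu, coroot_lattice mu & G = [set mu + x | x in F]].

(* Translations preserve colors, so the union below is over equal sets. *)
Definition orbit_colors (O : set (set V)) : {set 'I_n.+1} :=
  [set j | `[< exists2 F, O F & j \in cell_colors F >]]%SET.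

Definition steinberg_torus : colored_complex n :=
  ColoredComplex
    [set O | exists2 F, coxeter_cell F & O = lattice_orbit F] orbit_colors.

Definition reduced_steinberg_torus : colored_complex n :=
  ColoredComplex
    (@cells n steinberg_torus `\ lattice_orbit set0) orbit_colors.

End SimpleRoots.
End RootSystem.

(* Main.v *)
From HB Require Import structures.
Require Import Defs.
From mathcomp Require Import all_boot all_order all_algebra.
From mathcomp Require Import finmap boolp classical_sets functions.
From mathcomp Require Import cardinality fsbigop.
From mathcomp Require Import reals.
From mathcomp Require Import ring lra zify.
Import Order.TTheory GRing.Theory Num.Theory.
Local Open Scope classical_set_scope.
Local Open Scope ring_scope.

Set Implicit Arguments.
Unset Strict Implicit.
Unset Printing Implicit Defensive.

(** The affine Weyl group acts on [V] through words in the reflections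
    [affine_ref j] in the walls of the fundamental alcove.  Every root hyperplane
    functional is, up to sign, a nonnegative combination of the wall functionals
    [wall j], so no hyperplane cuts the alcove.  The exchange property then shows
    that the closed alcove is a strict fundamental domain, the stabilizer of a
    point of the face [A_K] being generated by the reflections in the walls [K].
    Hence the cells of color-set [J] of the torus are the cosets [w W_K],
    [K = ~: J], and each such coset contains exactly one [w] with
    [Des w \subset J]: perturbing a point of [A_K] in the direction of the
    Weyl-translates of the base point turns uniqueness into strictness of the
    fundamental domain.  The remaining identities are inclusion-exclusion. *)

(** When [K] contains [ord0], the group [W_K] need not be parabolic in W, so the usual theory of
    parabolic cosets in W does not reach it. It is, however, the linear part of the stabilizer of a
    point of [A_K] in the affine group, and there its generators come from wall reflections like any
    others. Everything about [W_K] is therefore proved for affine maps and then projected to linear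
    parts; this is why one word carries both [word_map] and [word_lin]. To return to the torus,
    every lattice translation has to be a word; this rests on the translation by the coroot of
    [theta], the product of the affine and the linear reflection attached to [theta]. The full set
    [K] is excluded because [A_K] is then empty. Its counterpart for descents is that no [w] has an
    empty descent set: the marks give a positive linear relation among the extended roots. *)

(** * Finite sets, cardinalities and sums over subsets *)

Lemma finite_set_param (F : finType) (T : choiceType) (r : F -> T -> Prop)
    (A : set T) :
  (forall f x y, r f x -> r f y -> x = y) ->
  (forall x, A x -> exists f, r f x) -> finite_set A.
Proof.
move=> r_inj rA; have [->|/set0P[x0 _]] := eqVneq A set0; first exact: finite_set0.
apply: (@sub_finite_set _ _ [set xget x0 (r f) | f in [set: F]]).
  move=> x /rA[f rf]; exists f => //.
  by apply: xget_unique => // y /r_inj; apply.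
exact/finite_image/finite_finset.
Qed.

Lemma finite_argmin (R : realType) (T : choiceType) (S : set T) (f : T -> R) x :
  finite_set S -> S x -> exists2 y, S y & forall z, S z -> f y <= f z.
Proof.
move=> /finite_seqP[s ->] /=; elim: s x => // x s IH y _.
have [s0|] := eqVneq s [::].
  by exists x; rewrite ?s0 /= ?inE // => z; rewrite inE => /eqP ->.
case: s IH => // z s IH _; have [t /= ts tmin] := IH z (mem_head _ _).
have [ft|tf] := leP (f t) (f x).
  exists t => [|u]; first by rewrite /= inE ts orbT.
  by rewrite /= inE => /orP[/eqP ->|/tmin].
exists x => [|u]; first by rewrite /= mem_head.
rewrite /= inE => /orP[/eqP -> //|/tmin]; exact/le_trans/ltW.
Qed.

(** Serves to push a point of a face into the open alcove. The bound holds for all smaller steps, so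
    that two directions can share one step. *)
Lemma small_perturbation (R : realFieldType) (I : eqType) (r : seq I)
    (a b : I -> R) :
  (forall i, i \in r -> 0 <= a i) ->
  (forall i, i \in r -> a i = 0 -> 0 < b i) ->
  exists2 e, 0 < e &
    forall d, 0 < d -> d <= e -> forall i, i \in r -> 0 < a i + d * b i.
Proof.
elim: r => [|i r IH] a0 b0; first by exists 1.
have [|j jr|e e0 eP] := IH.
- by move=> j jr; apply: a0; rewrite inE jr orbT.
- by apply: b0; rewrite inE jr orbT.
have [f f0 fP] : exists2 f, 0 < f &
    forall d, 0 < d -> d <= f -> 0 < a i + d * b i.
  have [ai0|ai] := eqVneq (a i) 0.
    exists 1 => // d d0 _; rewrite ai0 add0r mulr_gt0 // b0 // mem_head //.
  have {}ai : 0 < a i by rewrite lt_neqAle eq_sym ai a0 ?mem_head.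
  have c0 : 0 < 1 + `|b i| by rewrite ltr_pwDl.
  exists (a i / (2 * (1 + `|b i|))) => [|d d0].
    by rewrite divr_gt0 // mulr_gt0.
  rewrite ler_pdivlMr ?mulr_gt0 // => df.
  have := ler_norm (- b i); rewrite normrN => nb.
  have : 0 <= d * (`|b i| + b i) by rewrite mulr_ge0 ?(ltW d0) // -lerBlDr sub0r.
  have := mulr_gt0 d0 c0; lra.
exists (Num.min e f) => [|d d0]; first by rewrite lt_min e0.
rewrite le_min => /andP[de df] j; rewrite inE => /orP[/eqP->|]; first exact: fP.
exact: eP.
Qed.

Lemma fincardE (T : choiceType) (A : set T) (s : seq T) :
  uniq s -> (forall x, A x <-> x \in s) -> fincard A = size s.
Proof.
move=> s_uniq As; have -> : A = [set` s] by apply/seteqP; split=> x /As.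
apply/perm_size/uniq_perm => // x.
by rewrite in_fset_set ?mem_setE //; apply: finite_seq.
Qed.

Lemma fincard_image (T U : choiceType) (A : set T) (f : T -> U) :
  finite_set A -> (forall x y, A x -> A y -> f x = f y -> x = y) ->
  fincard [set f x | x in A] = fincard A.
Proof.
move=> /finite_seqP[s' ->] /= f_inj.
rewrite (@fincardE _ [set` s'] (undup s')) ?undup_uniq //; last first.
  by move=> x; rewrite mem_undup.
rewrite (@fincardE _ _ (map f (undup s'))) ?size_map // => [|u].
  rewrite map_inj_in_uniq ?undup_uniq // => x y.
  by rewrite !mem_undup; apply: f_inj.
split=> [[x xs <-]|/mapP[x + ->]]; first by rewrite map_f // mem_undup.
by rewrite mem_undup; exists x.
Qed.

Lemma fincardX (T U : choiceType) (A : set T) (B : set U) :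
  finite_set A -> finite_set B -> fincard (A `*` B) = (fincard A * fincard B)%N.
Proof.
move=> Af Bf; rewrite -(size_allpairs pair); apply: fincardE => [|[x y]].
  by apply: allpairs_uniq; rewrite ?fset_uniq // => -[? ?] [? ?] _ _ [-> ->].
split=> [[/= Ax By]|/allpairsP[[a b] /= [aA bB [-> ->]]]].
  by apply/allpairsP; exists (x, y); rewrite !in_fset_set ?mem_set.
by rewrite in_fset_set // in aA; rewrite in_fset_set // in bB; split; apply: set_mem.
Qed.

Lemma sum_supersets (I : finType) (A : comNzRingType) (x y : I -> A) (D : {set I}) :
  \sum_(J : {set I} | D \subset J)
     \prod_(j in J) x j * \prod_(j in ~: J) y j =
  \prod_(j in D) x j * \prod_(j in ~: D) (x j + y j).
Proof.
(* Replacing [y] by 0 on [D] kills exactly the terms of the expanded product whose [J] does not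
   contain [D]. *)
transitivity (\prod_j (x j + (if j \in D then 0 else y j))); last first.
  rewrite (bigID (mem D)) /=; congr (_ * _).
    by apply: eq_bigr => j ->; rewrite addr0.
  by apply: eq_big => [j|j /negPf ->]; rewrite ?inE.
rewrite bigA_distr big_mkcond /=; apply: eq_bigr => J _.
rewrite [RHS](bigID (mem J)) /=; case: ifP => [/fintype.subsetP DJ|].
  congr (_ * _); first by apply: eq_bigr => j ->.
  apply: eq_big => [j|j]; rewrite inE // => jJ.
  by rewrite (negPf jJ) (contraNF (DJ j)).
move=> /negbT/subsetPn[j jD jJ].
by rewrite [X in _ * X](bigD1 j) //= (negPf jJ) jD mul0r mulr0.
Qed.

Lemma inclusion_exclusion (I : finType) (J D : {set I}) :
  \sum_(K : {set I} | (K \subset J) && (D \subset K)) (-1) ^+ #|J :\: K| =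
  (D == J)%:R :> int.
Proof.
(* With these values the product of [x] over [K] tests [K \subset J], that of [y] over the
   complement is the sign, and [x + y] is 0 on [J] and 1 elsewhere, so that the closed form tests
   [D \subset J] and [J \subset D]. *)
have := @sum_supersets I int (fun j => (j \in J)%:R)
  (fun j => if j \in J then -1 else 1) D.
have prodJ (K : {set I}) : \prod_(j in K) (j \in J)%:R = (K \subset J)%:R :> int.
  have [/fintype.subsetP KJ|/subsetPn[j jK jJ]] := boolP (K \subset J).
    by rewrite big1 // => j /KJ ->.
  by rewrite (bigD1 j) //= (negPf jJ) mul0r.
rewrite prodJ [X in _ * X](_ : _ = (J \subset D)%:R); last first.
  have [/fintype.subsetP JD|/subsetPn[j jJ jD]] := boolP (J \subset D).
    rewrite big1 // => j; rewrite inE; case: ifP => [/JD ->//|_ _].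
    by rewrite add0r.
  by rewrite (bigD1 j) ?inE //= jJ subrr mul0r.
rewrite -natrM mulnb -finset.eqEsubset => <-.
rewrite big_mkcondl; apply: eq_bigr => K _; rewrite prodJ.
case: (K \subset J); rewrite ?mul0r // mul1r.
rewrite (bigID (mem J)) /= [X in _ * X]big1 ?mulr1 => [|j]; last first.
  by rewrite inE => /andP[_ /negPf ->].
rewrite (eq_bigr (fun=> -1)) => [|j /andP[_ ->]//].
rewrite prodr_const; congr (_ ^+ _); apply: eq_card => j.
by rewrite [RHS]unfold_in !inE.
Qed.

Lemma fincard_gt0 (T : choiceType) (A : set T) x :
  finite_set A -> A x -> (0 < fincard A)%N.
Proof.
move=> Afin Ax; rewrite /fincard -has_predT; apply/hasP.
by exists x; rewrite // in_fset_set ?mem_set.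
Qed.

(** * Euclidean reflections and coroots *)

Section Reflections.
Context (R : realType) (V : vectType R) (dot : {dot V for idfun}).
Implicit Types (u v b : V) (f : 'End(V)).

Lemma dotC u v : dot u v = dot v u.
Proof. by rewrite (hermC dot) expr0 mul1r. Qed.

Lemma dotDl u v w : dot (u + v) w = dot u w + dot v w.
Proof. exact: linearDl. Qed.

Lemma dotBl u v w : dot (u - v) w = dot u w - dot v w.
Proof. exact: linearBl. Qed.

Lemma dotNl u v : dot (- u) v = - dot u v.
Proof. exact: linearNl. Qed.

Lemma dotZl a u v : dot (a *: u) v = a * dot u v.
Proof. exact: linearZl_LR. Qed.

Lemma dot_suml I (r : seq I) (P : pred I) (F : I -> V) v :
  dot (\sum_(i <- r | P i) F i) v = \sum_(i <- r | P i) dot (F i) v.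
Proof. exact: linear_sumlz. Qed.

Lemma dot0l v : dot 0 v = 0.
Proof. exact: linear0l. Qed.

Lemma dotBr u v w : dot u (v - w) = dot u v - dot u w.
Proof. by rewrite dotC dotBl !(dotC u). Qed.

Lemma dotNr u v : dot u (- v) = - dot u v.
Proof. by rewrite dotC dotNl (dotC u). Qed.

Lemma dotZr a u v : dot u (a *: v) = a * dot u v.
Proof. by rewrite dotC dotZl (dotC u). Qed.

Lemma dot0r v : dot v 0 = 0.
Proof. by rewrite dotC dot0l. Qed.

Lemma dot_sumr I (r : seq I) (P : pred I) (F : I -> V) v :
  dot v (\sum_(i <- r | P i) F i) = \sum_(i <- r | P i) dot v (F i).
Proof. by rewrite dotC dot_suml; apply: eq_bigr => i _; rewrite dotC. Qed.

Lemma dot_gt0 v : v != 0 -> 0 < dot v v.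
Proof. exact: neq0_dnorm_gt0. Qed.

Lemma dot_ge0 v : 0 <= dot v v.
Proof. by have [->|/dot_gt0/ltW//] := eqVneq v 0; rewrite dot0l. Qed.

Lemma dot_eq0 v : dot v v = 0 -> v = 0.
Proof. by move=> h; apply/eqP; apply: contraTT isT => /dot_gt0; rewrite h ltxx. Qed.

Lemma Cauchy_Schwarz u v : (dot u v) ^+ 2 <= dot u u * dot v v.
Proof.
have [->|/dot_gt0 v0] := eqVneq v 0; first by rewrite !dot0r expr0n mulr0.
have := dot_ge0 (u - (dot u v / dot v v) *: v).
rewrite dotBl !dotBr !dotZl !dotZr (dotC v u) => /mulr_ge0 /(_ (ltW v0)) h.
rewrite -subr_ge0; apply: le_trans h _; rewrite le_eqVlt; apply/orP; left.
by apply/eqP; field; exact: lt0r_neq0.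
Qed.

(** With the coroot as direction the formula extends to affine reflections whose translation parts
    lie in the coroot lattice. *)
Lemma refl_coroot b v : reflection dot b v = v - dot v b *: coroot dot b.
Proof.
rewrite lfunE /= /reflection_fun /coroot dotZr scalerA.
by congr (_ - _ *: _); ring.
Qed.

Lemma dot_coroot b : b != 0 -> dot b (coroot dot b) = 2.
Proof. by move=> /dot_gt0 b0; rewrite dotZr divfK // gt_eqF. Qed.

Lemma corootN b : coroot dot (- b) = - coroot dot b.
Proof. by rewrite /coroot dotNl dotNr opprK scalerN. Qed.

Lemma reflN b : reflection dot (- b) = reflection dot b.
Proof.
by apply/lfunP => v; rewrite !refl_coroot dotNr corootN scalerN scaleNr opprK.
Qed.

Lemma reflK b : involutive (reflection dot b).
Proof.
move=> v; have [->|b0] := eqVneq b 0.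
  by rewrite !refl_coroot !dot0r !scale0r !subr0.
rewrite !refl_coroot dotBl dotZl (dotC (coroot dot b) b) dot_coroot //.
by rewrite -addrA -opprD -scalerDl [X in X *: _](_ : _ = 0) ?scale0r ?subr0 //; ring.
Qed.

Lemma dot_refl b u v : dot (reflection dot b u) v = dot u (reflection dot b v).
Proof.
rewrite !refl_coroot dotBl dotBr dotZl dotZr /coroot dotZl dotZr (dotC b v).
by congr (_ - _); ring.
Qed.

Lemma refl_isom b u v :
  dot (reflection dot b u) (reflection dot b v) = dot u v.
Proof. by rewrite dot_refl reflK. Qed.

Lemma coroot_isom f b : dot (f b) (f b) = dot b b ->
  coroot dot (f b) = f (coroot dot b).
Proof. by move=> h; rewrite /coroot h linearZZ. Qed.

Lemma refl_conj f b v : (forall u v, dot (f u) (f v) = dot u v) ->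
  reflection dot (f b) (f v) = f (reflection dot b v).
Proof.
move=> h; rewrite !refl_coroot coroot_isom // h.
by rewrite (linearB f) (linearZZ f (dot v b)).
Qed.

End Reflections.

Section AffineWeylGroup.
Context (R : realType) (V : vectType R) (dot : {dot V for idfun}).
Context (n : nat) (Phi : set V) (alpha : 'I_n -> V) (theta : V).
Hypothesis Phi_root : root_system dot Phi.
Hypothesis alpha_simple : simple_roots Phi alpha.
Hypothesis theta_highest : highest_root Phi alpha theta.
Implicit Types (u v y b : V) (i : 'I_n) (j : 'I_n.+1) (J K : {set 'I_n.+1}).
Implicit Types (s : seq 'I_n.+1) (k : int).

Local Notation sref := (reflection dot).
Local Notation "b ^v" := (coroot dot b) (at level 2, format "b ^v").
Local Notation ext := (ext_root alpha theta).
Local Notation ref := (ext_reflection dot alpha theta).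

(** * The dual basis of the simple roots *)

Lemma simple_span v : exists c : 'I_n -> R, v = \sum_i c i *: alpha i.
Proof.
have [_ /andP[/eqP span_alpha _] _] := alpha_simple.
have : v \in <<[seq alpha i | i : 'I_n]>>%VS by rewrite span_alpha memvf.
rewrite span_def big_map big_enum /= => /memv_sumP[w wP ->].
have wE i : exists c, w i = c *: alpha i.
  by have /vlineP := wP i isT.
by exists (fun i => sval (cid (wE i))); apply: eq_bigr => i _; case: cid.
Qed.

Lemma dot_simple_inj v : (forall i, dot v (alpha i) = 0) -> v = 0.
Proof.
move=> v0; apply: (@dot_eq0 _ _ dot); have [c vE] := simple_span v.
by rewrite {2}vE dot_sumr big1 // => i _; rewrite dotZr v0 mulr0.
Qed.

(** Pairing with the simple roots is an injective linear map between spaces of the same dimension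
    [n]. *)
Lemma dot_simple_surj (c : 'I_n -> R) :
  exists v, forall i, dot v (alpha i) = c i.
Proof.
pose L v : 'rV[R]_n := \row_i dot v (alpha i).
have Llin : linear L.
  by move=> a u v; apply/rowP => i; rewrite !mxE dotDl dotZl.
pose Lm := GRing.isLinear.Build _ _ _ _ L Llin.
pose LL : {linear V -> 'rV[R]_n} := HB.pack L Lm.
have LE v : linfun LL v = L v by rewrite lfunE.
have ker0 : (lker (linfun LL) == 0)%VS.
  rewrite -subv0; apply/subvP => v; rewrite memv_ker memv0 LE => /eqP Lv0.
  by apply/eqP/dot_simple_inj => i; have /rowP/(_ i) := Lv0; rewrite !mxE.
have img_full : (limg (linfun LL) = fullv)%VS.
  apply/eqP; rewrite eqEdim subvf limg_dim_eq; last first.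
    by rewrite (eqP ker0) capv0.
  have [_ /size_basis szE _] := alpha_simple; rewrite szE.
  by rewrite card_ord dimvf /dim /= mul1n.
have /memv_imgP[v _ vE] : \row_i c i \in limg (linfun LL).
  by rewrite img_full memvf.
exists v => i; have /rowP/(_ i) := vE.
by rewrite LE !mxE.
Qed.

Lemma dual_basis_exists i :
  exists v, forall l, dot v (alpha l) = (l == i)%:R.
Proof. exact: dot_simple_surj. Qed.

(** The fundamental coweights: pairing with [dual i] reads off the coefficient of [alpha i]. *)
Definition dual i := sval (cid (dual_basis_exists i)).

Lemma dot_dual i l : dot (alpha l) (dual i) = (l == i)%:R.
Proof. by rewrite dotC /dual; case: cid => /= v ->. Qed.

Lemma dual_expand v : v = \sum_i dot v (dual i) *: alpha i.
Proof.
have [c ->] := simple_span v; apply: eq_bigr => i _; congr (_ *: _).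
rewrite dot_suml (bigD1 i) //= dotZl dot_dual eqxx mulr1 big1 ?addr0 //.
by move=> l li; rewrite dotZl dot_dual (negPf li) mulr0.
Qed.

Lemma nonneg_comb_ge0 v i : nonneg_comb alpha v -> 0 <= dot v (dual i).
Proof.
move=> [c ->]; rewrite dot_suml sumr_ge0 // => l _.
by rewrite -scaler_nat dotZl dot_dual -natrM ler0n.
Qed.

Lemma simple_neq0 i : alpha i != 0.
Proof. by apply: (root_neq0 Phi_root); have [] := alpha_simple. Qed.

Lemma simple_root i : Phi (alpha i).
Proof. by have [] := alpha_simple. Qed.

Lemma highest_in : Phi theta.
Proof. by have [] := theta_highest. Qed.

Lemma rootN b : Phi b -> Phi (- b).
Proof.
move=> Pb; have := root_reflection Phi_root Pb Pb.
rewrite refl_coroot /coroot scalerA mulrC divfK; last first.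
  by rewrite lt0r_neq0 ?dot_gt0 ?(root_neq0 Phi_root).
by rewrite scaler_nat mulr2n opprD addrA subrr add0r.
Qed.

Lemma root_sign b : Phi b -> nonneg_comb alpha b \/ nonneg_comb alpha (- b).
Proof. by have [_ _] := alpha_simple; apply. Qed.

Lemma le_highest b i : Phi b -> dot b (dual i) <= dot theta (dual i).
Proof.
move=> Pb; rewrite -subr_ge0 -dotBl; apply: nonneg_comb_ge0.
by have [_] := theta_highest; apply.
Qed.

Lemma highest_coef_ge1 i : 1 <= dot theta (dual i).
Proof. by have := le_highest i (simple_root i); rewrite dot_dual eqxx. Qed.

Lemma ext0 : ext ord0 = - theta.
Proof. by rewrite /ext_root unlift_none. Qed.

Lemma extS i : ext (lift ord0 i) = alpha i.
Proof. by rewrite /ext_root liftK. Qed.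

Lemma ext_rootP j : Phi (ext j).
Proof.
case: (unliftP ord0 j) => [i|] ->; first by rewrite extS; apply: simple_root.
by rewrite ext0; apply/rootN/highest_in.
Qed.

Lemma ext_neq0 j : ext j != 0.
Proof. exact/(root_neq0 Phi_root)/ext_rootP. Qed.

Lemma ext_reflE j : ref j = sref (ext j).
Proof.
by rewrite /ext_reflection /ext_root; case: unlift => // ; rewrite reflN.
Qed.

(** * Wall functionals and faces of the fundamental alcove *)

Definition wall j y : R := dot y (ext j) + (j == ord0)%:R.

Lemma wall0 y : wall ord0 y = 1 - dot y theta.
Proof. by rewrite /wall ext0 dotNr eqxx addrC. Qed.

Lemma wallS i y : wall (lift ord0 i) y = dot y (alpha i).
Proof. by rewrite /wall extS eq_sym (negPf (neq_lift _ _)) addr0. Qed.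

(* The coefficients of the relation [\sum_j mark j * wall j = 1]. *)
Definition mark j : R :=
  if unlift ord0 j is Some i then dot theta (dual i) else 1.

Lemma mark0 : mark ord0 = 1.
Proof. by rewrite /mark unlift_none. Qed.

Lemma markS i : mark (lift ord0 i) = dot theta (dual i).
Proof. by rewrite /mark liftK. Qed.

Lemma mark_gt0 j : 0 < mark j.
Proof.
case: (unliftP ord0 j) => [i|] ->; last by rewrite mark0.
by rewrite markS (lt_le_trans _ (highest_coef_ge1 i)).
Qed.

Lemma sum_wallS (c : 'I_n -> R) y :
  \sum_i c i * wall (lift ord0 i) y = dot y (\sum_i c i *: alpha i).
Proof. by rewrite dot_sumr; apply: eq_bigr => i _; rewrite wallS dotZr. Qed.

Lemma sum_mark_wall y : \sum_j mark j * wall j y = 1.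
Proof.
rewrite big_ord_recl mark0 mul1r wall0.
under eq_bigr do rewrite markS.
by rewrite sum_wallS -dual_expand subrK.
Qed.

(** The walls are barycentric coordinates up to scaling: the relation with the marks is the only
    constraint on their values. *)
Lemma wall_surj (a : 'I_n.+1 -> R) : \sum_j mark j * a j = 1 ->
  exists y, forall j, wall j y = a j.
Proof.
move=> a1; have [y yE] := dot_simple_surj (fun i => a (lift ord0 i)).
have yS i : wall (lift ord0 i) y = a (lift ord0 i) by rewrite wallS yE.
exists y => j; case: (unliftP ord0 j) => [i|] -> //.
have := sum_mark_wall y; rewrite -a1 !big_ord_recl mark0 !mul1r.
by under eq_bigr do rewrite yS; move/addIr.
Qed.

Lemma alcove_faceP J y : alcove_face dot alpha theta J y <->
  forall j, if j \in J then wall j y = 0 else 0 < wall j y.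
Proof.
split=> [[yS y0] j|yP].
  case: (unliftP ord0 j) => [i|] ->; first by rewrite wallS; apply: yS.
  by rewrite wall0; case: ifP y0 => _; [move=> ->; rewrite subrr|rewrite subr_gt0].
split=> [i|]; first by have := yP (lift ord0 i); rewrite wallS.
have := yP ord0; rewrite wall0; case: ifP => _; last by rewrite subr_gt0.
by move/eqP; rewrite subr_eq0 eq_sym => /eqP.
Qed.

Lemma alcove_face_nonempty J : J != [set: 'I_n.+1]%SET ->
  exists y, alcove_face dot alpha theta J y.
Proof.
rewrite -finset.subTset => /subsetPn[j1 _ j1J].
(* Equal wall values off [J], to be rescaled so that the relation with the marks holds; [j1] makes
   the total positive. *)
pose a j : R := (j \notin J)%:R.
have a_ge0 j : 0 <= mark j * a j.
  by rewrite mulr_ge0 ?ler0n // ltW ?mark_gt0.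
have S_gt0 : 0 < \sum_j mark j * a j.
  rewrite (bigD1 j1) //= ltr_pwDl ?sumr_ge0 // /a j1J mulr1.
  exact: mark_gt0.
have [|y yE] := @wall_surj (fun j => a j / \sum_j mark j * a j).
  under eq_bigr do rewrite mulrA.
  by rewrite -mulr_suml divff ?gt_eqF.
exists y; apply/alcove_faceP => j; rewrite yE /a.
by case: (j \in J) => /=; rewrite ?mul0r ?divr_gt0.
Qed.

Definition closed_alcove y := forall j, 0 <= wall j y.

Lemma alcove_face_closed J y :
  alcove_face dot alpha theta J y -> closed_alcove y.
Proof. by move/alcove_faceP => yP j; have := yP j; case: ifP => [_ ->|_ /ltW]. Qed.

Lemma full_face_empty y :
  ~ alcove_face dot alpha theta [set: 'I_n.+1]%SET y.
Proof.
move/alcove_faceP => yP; have := sum_mark_wall y.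
rewrite big1 => [/esym/eqP|j _]; first by rewrite oner_eq0.
by have := yP j; rewrite finset.in_setT => ->; rewrite mulr0.
Qed.

Lemma alcove_vertex j : exists2 y, closed_alcove y &
  forall l, (wall l y == 0) = (l != j).
Proof.
have [|y yE] := @wall_surj (fun l => (l == j)%:R / mark j).
  rewrite (bigD1 j) //= eqxx mul1r divff ?gt_eqF ?mark_gt0 // big1 ?addr0 //.
  by move=> l /negPf->; rewrite mul0r mulr0.
exists y => l; rewrite yE; first by rewrite divr_ge0 ?ler0n // ltW ?mark_gt0.
rewrite mulf_eq0 invr_eq0 (gt_eqF (mark_gt0 j)) orbF.
by case: (l == j); rewrite /= ?oner_eq0 ?eqxx.
Qed.

Lemma alcove_face_walls y : closed_alcove y ->
  alcove_face dot alpha theta [set j | wall j y == 0]%SET y.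
Proof.
move=> yP; apply/alcove_faceP => j; rewrite inE.
by case: eqP => // /eqP y0; rewrite lt_neqAle eq_sym y0 yP.
Qed.

(** * Words in the wall reflections and their linear parts *)

Definition affine_ref j y := y - wall j y *: (ext j)^v.

(** A word stands for an element of the affine group: [word_map] is its action and [word_lin] its
    linear part. Reversal gives inverses, so no group structure has to be built. *)
Definition word_map s y := foldr affine_ref y s.

Definition word_lin s : 'End(V) := foldr (fun j f => (ref j \o f)%VF) \1%VF s.

Lemma affine_refE j y : affine_ref j y = ref j y - (j == ord0)%:R *: (ext j)^v.
Proof. by rewrite ext_reflE refl_coroot -addrA -opprD -scalerDl. Qed.

Lemma wall_affine_ref j l y :
  wall l (affine_ref j y) = wall l y - wall j y * dot (ext j)^v (ext l).
Proof. by rewrite /wall dotBl dotZl addrAC. Qed.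

Lemma affine_refK j : involutive (affine_ref j).
Proof.
move=> y; rewrite {1}/affine_ref wall_affine_ref (dotC dot (ext j)^v).
rewrite dot_coroot ?ext_neq0 // /affine_ref -addrA -opprD -scalerDl.
by rewrite [X in X *: _](_ : _ = 0) ?scale0r ?subr0 //; ring.
Qed.

Lemma word_map_cat s t y : word_map (s ++ t) y = word_map s (word_map t y).
Proof. exact: foldr_cat. Qed.

Lemma word_map_rcons s j y :
  word_map (rcons s j) y = word_map s (affine_ref j y).
Proof. by rewrite -cats1 word_map_cat. Qed.

Lemma word_mapK s : cancel (word_map s) (word_map (rev s)).
Proof.
elim: s => //= j s IH y.
by rewrite rev_cons word_map_rcons affine_refK IH.
Qed.

Lemma word_mapVK s : cancel (word_map (rev s)) (word_map s).
Proof. by move=> y; rewrite -{1}(revK s) word_mapK. Qed.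

Lemma word_lin_cons j s v : word_lin (j :: s) v = ref j (word_lin s v).
Proof. by rewrite comp_lfunE. Qed.

Lemma word_lin_cat s t v : word_lin (s ++ t) v = word_lin s (word_lin t v).
Proof.
elim: s v => [|j s IH] v; first by rewrite id_lfunE.
by rewrite !word_lin_cons IH.
Qed.

Lemma word_lin1 j v : word_lin [:: j] v = ref j v.
Proof. by rewrite word_lin_cons id_lfunE. Qed.

Lemma word_mapE s y : word_map s y = word_lin s y + word_map s 0.
Proof.
elim: s => [|j s IH]; first by rewrite id_lfunE addr0.
rewrite /= !affine_refE -/(word_map s y) -/(word_map s 0) IH.
by rewrite linearD word_lin_cons addrA.
Qed.

Lemma word_lin_isom s u v : dot (word_lin s u) (word_lin s v) = dot u v.
Proof.
elim: s => [|j s IH]; first by rewrite !id_lfunE.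
by rewrite !word_lin_cons ext_reflE refl_isom IH.
Qed.

Lemma word_linK s : cancel (word_lin s) (word_lin (rev s)).
Proof.
elim: s => [|j s IH] v; first by rewrite !id_lfunE.
rewrite rev_cons -cats1 word_lin_cat word_lin1 word_lin_cons.
by rewrite ext_reflE reflK IH.
Qed.

Lemma word_linVK s : cancel (word_lin (rev s)) (word_lin s).
Proof. by move=> v; rewrite -{1}(revK s) word_linK. Qed.

Lemma dot_word_lin s u v : dot (word_lin s u) v = dot u (word_lin (rev s) v).
Proof. by rewrite -{1}(word_linVK s v) word_lin_isom. Qed.

Lemma word_map_sub s y z : word_map s y - word_map s z = word_lin s (y - z).
Proof.
by rewrite (word_mapE s y) (word_mapE s z) opprD addrACA subrr addr0 linearB.
Qed.

Lemma word_lin_root s b : Phi b -> Phi (word_lin s b).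
Proof.
elim: s => [|j s IH] Pb; first by rewrite id_lfunE.
rewrite word_lin_cons ext_reflE; apply: (root_reflection Phi_root) (IH Pb).
exact: ext_rootP.
Qed.

Lemma word_lin_coroot s b : (word_lin s b)^v = word_lin s b^v.
Proof. by rewrite coroot_isom // word_lin_isom. Qed.

(** * The coroot lattice *)

Local Notation lattice := (coroot_lattice dot Phi).

Lemma latticeP mu : lattice mu <-> exists c : V -> int,
  mu = \sum_(b <- enum_fset (fset_set Phi)) b^v *~ c b.
Proof.
have fin := root_finite Phi_root.
by split=> -[c ->]; exists c; rewrite fsbig_finite.
Qed.

Lemma lattice0 : lattice 0.
Proof.
by apply/latticeP; exists (fun=> 0); rewrite big1 // => b _; rewrite mulr0z.
Qed.

Lemma latticeD mu nu : lattice mu -> lattice nu -> lattice (mu + nu).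
Proof.
move=> /latticeP[c ->] /latticeP[d ->]; apply/latticeP.
exists (fun b => c b + d b); rewrite -big_split /=.
by apply: eq_bigr => b _; rewrite mulrzDr.
Qed.

Lemma latticeN mu : lattice mu -> lattice (- mu).
Proof.
move=> /latticeP[c ->]; apply/latticeP; exists (fun b => - c b).
by rewrite -sumrN; apply: eq_bigr => b _; rewrite mulrNz.
Qed.

Lemma lattice_coroot b : Phi b -> lattice b^v.
Proof.
move=> Pb; apply/latticeP; exists (fun x => (x == b)%:Z).
have fin := root_finite Phi_root.
rewrite (bigD1_seq b) /= ?fset_uniq ?in_fset_set ?mem_set //.
by rewrite eqxx mulr1z big1 ?addr0 // => x /negPf ->; rewrite mulr0z.
Qed.

Lemma lattice_ind (P : V -> Prop) : P 0 ->
  (forall u v, P u -> P v -> P (u + v)) -> (forall u, P u -> P (- u)) ->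
  (forall b, Phi b -> P b^v) -> forall mu, lattice mu -> P mu.
Proof.
move=> P0 PD PN Pc mu /latticeP[c ->].
rewrite big_seq; apply: big_ind => // b.
rewrite in_fset_set ?inE; last exact: root_finite Phi_root.
move=> /Pc Pb; have Pn m : P (b^v *+ m).
  by elim: m => [|m IH]; rewrite ?mulr0n // mulrS; apply: PD.
case: (c b) => m; first by rewrite -pmulrn.
by rewrite NegzE mulrNz -pmulrn; apply: PN.
Qed.

Lemma lattice_lin s mu : lattice mu -> lattice (word_lin s mu).
Proof.
apply: (lattice_ind (P := fun mu => lattice (word_lin s mu))).
- by rewrite linear0; apply: lattice0.
- by move=> u v ? ?; rewrite linearD; apply: latticeD.
- by move=> u ?; rewrite linearN; apply: latticeN.
by move=> b Pb; rewrite -word_lin_coroot; apply/lattice_coroot/word_lin_root.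
Qed.

Lemma lattice_int mu b : lattice mu -> Phi b -> dot mu b \is a Num.int.
Proof.
move=> Lmu Pb; move: mu Lmu.
apply: (lattice_ind (P := fun mu => dot mu b \is a Num.int)).
- by rewrite dot0l rpred0.
- by move=> u v ? ?; rewrite dotDl rpredD.
- by move=> u ?; rewrite dotNl rpredN.
by move=> c Pc; rewrite dotC; apply: (root_crystallographic Phi_root).
Qed.

Lemma lattice_word s : lattice (word_map s 0).
Proof.
elim: s => [|j s IH]; first exact: lattice0.
rewrite /= affine_refE; apply: latticeD.
  by rewrite -word_lin1; apply: lattice_lin.
apply: latticeN; case: eqP => _; rewrite ?scale0r ?scale1r.
  exact/lattice_coroot/ext_rootP.
exact: lattice0.
Qed.

(** * Signs of the root functionals on the alcove *)

(** Words permute the affine root functionals, since their translation parts lie in the coroot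
    lattice and pair integrally with roots. *)
Lemma dot_word_mapE s b k : Phi b -> exists k' : int, forall y,
  dot (word_map s y) b + k%:~R = dot y (word_lin (rev s) b) + k'%:~R.
Proof.
move=> Pb; have /intrP[m mE] := lattice_int (lattice_word s) Pb.
exists (m + k) => y; rewrite word_mapE dotDl dot_word_lin mE.
by rewrite -addrA -intrD.
Qed.

(* Since [1 = \sum_j mark j * wall j], a positive root [b] and [k >= 0] give
   nonnegative coefficients directly, and [k < 0] gives those of
   [(theta - b) + (1 - theta) + (- k - 1)]. *)
Lemma root_walls b k : Phi b -> exists2 c : 'I_n.+1 -> R,
  forall j, 0 <= c j &
  exists e : bool, forall y,
    (-1) ^+ e * (dot y b + k%:~R) = \sum_j c j * wall j y.
Proof.
move=> Pb; wlog bpos : b k Pb / nonneg_comb alpha b.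
  move=> H; have [|Nb] := root_sign Pb; first exact: H.
  have [c c0 [e cE]] := H (- b) (- k) (rootN Pb) Nb.
  exists c => //; exists (~~ e) => y; rewrite -cE dotNr rmorphN /= -opprD.
  by rewrite mulrN; case: e {cE}; rewrite /= ?expr1 ?expr0; ring.
pose a i := dot b (dual i).
have a0 i : 0 <= a i by apply: nonneg_comb_ge0.
have bE y : dot y b = \sum_i a i * wall (lift ord0 i) y.
  by rewrite sum_wallS -dual_expand.
case: k => k.
  exists (fun j => (if unlift ord0 j is Some i then a i else 0) + k%:R * mark j).
    move=> j; rewrite addr_ge0 // ?mulr_ge0 ?ler0n // ?(ltW (mark_gt0 _)) //.
    by case: unlift.
  exists false => y; rewrite mul1r.
  under eq_bigr do rewrite mulrDl -mulrA.
  rewrite big_split -mulr_sumr /= sum_mark_wall mulr1 big_ord_recl.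
  rewrite unlift_none mul0r add0r.
  by under eq_bigr do rewrite liftK; rewrite -bE.
exists (fun j => (if unlift ord0 j is Some i then dot theta (dual i) - a i else 1)
                 + k%:R * mark j).
  move=> j; rewrite addr_ge0 // ?mulr_ge0 ?ler0n // ?(ltW (mark_gt0 _)) //.
  by case: unlift => // i; rewrite subr_ge0 le_highest.
exists true => y.
under eq_bigr do rewrite mulrDl -mulrA.
rewrite big_split -mulr_sumr /= sum_mark_wall mulr1 big_ord_recl.
rewrite unlift_none mul1r.
under eq_bigr do rewrite liftK mulrBl.
rewrite sumrB -bE sum_wallS -dual_expand wall0 NegzE.
by rewrite -[k.+1]addn1 rmorphN /= -pmulrn natrD; ring.
Qed.

(** On a face all terms are nonnegative, and a term is positive exactly when its wall is not in [J]
    and its coefficient is nonzero; the sign thus depends on the face alone. *)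
Lemma sum_wall_sg J y (c : 'I_n.+1 -> R) : (forall j, 0 <= c j) ->
  alcove_face dot alpha theta J y ->
  Num.sg (\sum_j c j * wall j y) =
  (~~ [forall j, (j \in J) || (c j == 0)])%:R.
Proof.
move=> c0 /alcove_faceP yJ.
have w0 j : 0 <= c j * wall j y.
  by rewrite mulr_ge0 //; have := yJ j; case: ifP => [_ ->|_ /ltW].
case: forallP => [cJ|/existsNP[l /negP]].
  rewrite big1 ?sgr0 // => j _; have := yJ j; have := cJ j.
  by case: ifP => /= [_ _ ->|_ /eqP-> _]; rewrite ?mulr0 ?mul0r.
rewrite negb_or => /andP[lJ cl]; rewrite gtr0_sg // (bigD1 l) //=.
rewrite ltr_pwDl ?sumr_ge0 // mulr_gt0 ?lt_neqAle 1?eq_sym ?cl ?c0 //.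
by have := yJ l; rewrite (negPf lJ) lt_neqAle eq_sym.
Qed.

Lemma root_face_sg J x y b k : Phi b ->
  alcove_face dot alpha theta J x -> alcove_face dot alpha theta J y ->
  Num.sg (dot x b + k%:~R) = Num.sg (dot y b + k%:~R).
Proof.
move=> Pb xJ yJ; have [c c0 [e cE]] := root_walls k Pb.
have sgE z : Num.sg (dot z b + k%:~R) =
    (-1) ^+ e * Num.sg (\sum_j c j * wall j z).
  rewrite -cE sgrM sgrX sgrN sgr1 mulrA -exprD addnn -mul2n mulnC exprM.
  by rewrite sqrr_sign mul1r.
by rewrite !sgE !(sum_wall_sg c0 (J := J)).
Qed.

Lemma base_point_exists : exists y, forall j, 0 < wall j y.
Proof.
have [|y /alcove_faceP yP] := @alcove_face_nonempty finset.set0.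
  by apply/eqP => /setP/(_ ord0); rewrite !inE.
by exists y => j; have := yP j; rewrite inE.
Qed.

Definition base_point := sval (cid base_point_exists).

Lemma base_wall_gt0 j : 0 < wall j base_point.
Proof. by rewrite /base_point; case: cid. Qed.

Lemma root_base_neq0 b k : Phi b -> dot base_point b + k%:~R != 0.
Proof.
move=> Pb; apply/eqP => h0; have [c c0 [e cE]] := root_walls k Pb.
have c_eq0 j : c j = 0.
  have /eqP := cE base_point; rewrite h0 mulr0 eq_sym psumr_eq0 => [|l _].
    move=> /allP/(_ j (mem_index_enum j)) /=.
    by rewrite mulf_eq0 (gt_eqF (base_wall_gt0 j)) orbF => /eqP.
  by rewrite mulr_ge0 // ltW // base_wall_gt0.
(* With all coefficients zero the functional would vanish identically; its values at [b] and at 0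
   then give [dot b b = 0]. *)
have h00 y : dot y b + k%:~R = 0.
  have := cE y; rewrite big1 => [/eqP|j _]; last by rewrite c_eq0 mul0r.
  by rewrite mulf_eq0 signr_eq0 => /eqP.
have : dot b b = 0 by have := h00 b; have := h00 0; rewrite dot0l; lra.
by move/dot_eq0 => b0; have := root_neq0 Phi_root Pb; rewrite b0 eqxx.
Qed.

(** The value at the base point fixes the sign in [root_walls], which then applies to the whole
    closed alcove. *)
Lemma root_base_ge0 b k y : Phi b -> 0 < dot base_point b + k%:~R ->
  closed_alcove y -> 0 <= dot y b + k%:~R.
Proof.
move=> Pb h0 y0; have [c c0 [[] cE]] := root_walls k Pb.
  have : 0 <= \sum_j c j * wall j base_point.
    by apply: sumr_ge0 => j _; rewrite mulr_ge0 // ltW // base_wall_gt0.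
  by rewrite -cE expr1 mulN1r oppr_ge0 leNgt h0.
have := cE y; rewrite expr0 mul1r => ->.
by apply: sumr_ge0 => j _; rewrite mulr_ge0.
Qed.

(* If [h > 0] at the base point and [h \o affine_ref i < 0] there, then [h] is
   [\sum_j c j * wall j] and [h \o affine_ref i] is [- \sum_j d j * wall j] with
   [c, d >= 0]; they differ by a multiple of [wall i], so evaluating at the
   vertices of the alcove kills [c j] for [j != i]. *)
Lemma adjacent_alcoves b k (i : 'I_n.+1) : Phi b -> 0 < dot base_point b + k%:~R ->
  dot (affine_ref i base_point) b + k%:~R < 0 ->
  b = ext i /\ k%:~R = (i == ord0)%:R :> R.
Proof.
move=> Pb h0 h1; have [k' kE] := dot_word_mapE [:: i] k Pb.
have Pb' : Phi (word_lin (rev [:: i]) b) by apply: word_lin_root.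
have [c c0 [e cE]] := root_walls k Pb.
have [d d0 [f dE]] := root_walls k' Pb'.
have sum_ge0 (a : 'I_n.+1 -> R) : (forall j, 0 <= a j) ->
    0 <= \sum_j a j * wall j base_point.
  by move=> a0; apply: sumr_ge0 => j _; rewrite mulr_ge0 // ltW // base_wall_gt0.
have e0 : e = false.
  case: e cE => // cE; have := sum_ge0 _ c0.
  by rewrite -cE expr1 mulN1r oppr_ge0 leNgt h0.
have f1 : f = true.
  case: f dE => // dE; have := sum_ge0 _ d0.
  by rewrite -dE expr0 mul1r -kE leNgt /= h1.
rewrite {}e0 {}f1 in cE dE.
have cl0 l : l != i -> c l = 0.
  move=> li; have [y y0 yl] := alcove_vertex l.
  have yi : wall i y = 0 by apply/eqP; rewrite yl eq_sym.
  have ki := kE y; rewrite /= /affine_ref yi scale0r subr0 in ki.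
  have sumE (a : 'I_n.+1 -> R) : \sum_j a j * wall j y = a l * wall l y.
    rewrite (bigD1 l) //= big1 ?addr0 // => j jl.
    by have /eqP-> : wall j y == 0; rewrite ?yl ?mulr0.
  have wl : 0 < wall l y by rewrite lt_neqAle y0 eq_sym yl eqxx.
  have cly := cE y; have dly := dE y; rewrite !sumE -?ki in cly dly.
  have : (c l + d l) * wall l y = 0.
    by rewrite mulrDl -cly -dly expr0 expr1; ring.
  move/eqP; rewrite mulf_eq0 (gt_eqF wl) orbF paddr_eq0 //.
  by case/andP => /eqP.
have hE y : dot y b + k%:~R = c i * wall i y.
  have := cE y; rewrite expr0 mul1r => ->.
  by rewrite (bigD1 i) //= big1 ?addr0 // => j /cl0 ->; rewrite mul0r.
have kci : k%:~R = c i * (i == ord0)%:R.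
  by have := hE 0; rewrite /wall !dot0l !add0r.
have bE : b = c i *: ext i.
  apply/eqP; rewrite -subr_eq0; apply/eqP/(@dot_eq0 _ _ dot).
  set y := b - _; have := hE y; rewrite kci /wall mulrDr => /addIr.
  by rewrite {2}/y dotBr dotZr => ->; rewrite subrr.
have [|ci|ci] := root_reduced Phi_root (ext_rootP i) (c := c i).
- by rewrite -bE.
- by rewrite bE kci ci scale1r mul1r.
by have := c0 i; rewrite ci oppr_ge0 ler10.
Qed.

(** * Exchange property and strict fundamental domain *)

Lemma wall_word_map j s : exists k : int, forall y,
  wall j (word_map s y) = dot y (word_lin (rev s) (ext j)) + k%:~R.
Proof.
have [k kE] := dot_word_mapE s ((j == ord0)%:Z) (ext_rootP j).
by exists k => y; rewrite -kE -pmulrn.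
Qed.

(** The prefixes of the word move the base point through a gallery of adjacent alcoves. The letter
    at which the gallery crosses wall [j] is deleted when the reflection in that wall is applied. *)
Lemma word_map_exchange j s : wall j (word_map s base_point) < 0 ->
  exists2 t, (size t < size s)%N &
    forall y, affine_ref j (word_map s y) = word_map t y.
Proof.
elim/last_ind: s => [|s i IH] /=.
  by rewrite ltNge (ltW (base_wall_gt0 j)).
have [k kE] := wall_word_map j s; rewrite word_map_rcons => hi.
have Pb : Phi (word_lin (rev s) (ext j)) by apply/word_lin_root/ext_rootP.
have [h0|h0] := ltP (wall j (word_map s base_point)) 0.
  have [t ts tE] := IH h0; exists (rcons t i) => [|y].
    by rewrite !size_rcons ltnS.
  by rewrite !word_map_rcons tE.
have {}h0 : 0 < wall j (word_map s base_point).
  by rewrite lt_neqAle h0 kE eq_sym root_base_neq0.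
(* The crossing occurs at the last letter [i]: the pullback of [wall j] along [s] is then [wall i],
   so that the reflection [j] after [s] equals [s] after the reflection [i], which cancels the last
   letter. *)
rewrite !kE in h0 hi; have [bE kE'] := adjacent_alcoves Pb h0 hi.
exists s => [|y]; first by rewrite size_rcons.
rewrite word_map_rcons; set z := affine_ref i y.
rewrite /affine_ref kE bE kE' -/(wall i z).
rewrite -(word_linVK s (ext j)) bE word_lin_coroot -linearZZ.
have -> : wall i z *: (ext i)^v = z - y.
  by rewrite -(affine_refK i y) -/z /affine_ref subKr.
by rewrite /= -word_map_sub subKr.
Qed.

Lemma wall_affine_ref_self j y : wall j (affine_ref j y) = - wall j y.
Proof.
rewrite wall_affine_ref dotC dot_coroot ?ext_neq0 //.
by rewrite mulr_natr mulr2n opprD addrA subrr add0r.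
Qed.

Lemma word_map_fix s y : all (fun j => wall j y == 0) s -> word_map s y = y.
Proof.
elim: s => //= j s IH /andP[/eqP yj /IH ->].
by rewrite /affine_ref yj scale0r subr0.
Qed.

Lemma wall_word_map_sign j s y : closed_alcove y ->
  wall j (word_map s base_point) < 0 -> wall j (word_map s y) <= 0.
Proof.
move=> y0; have [k kE] := wall_word_map j s; rewrite !kE => h0.
have Pb : Phi (word_lin (rev s) (ext j)) by apply/word_lin_root/ext_rootP.
have := @root_base_ge0 _ (- k) y (rootN Pb).
by rewrite !dotNr !rmorphN /= -!opprD oppr_ge0 oppr_gt0; apply.
Qed.

Lemma wall_word_map_neq0 j s : wall j (word_map s base_point) != 0.
Proof.
have [k ->] := wall_word_map j s.
by apply/root_base_neq0/word_lin_root/ext_rootP.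
Qed.

(* The closed alcove is a strict fundamental domain, and the stabilizer of a
   point is generated by the reflections in the walls containing it. *)
Lemma closed_alcove_strict s y :
  closed_alcove y -> closed_alcove (word_map s y) ->
  exists2 t, all (fun j => wall j y == 0) t & word_map s =1 word_map t.
Proof.
have [m] := ubnP (size s); elim: m s => // m IH [|j s] sm y0 sy0.
  by exists [::].
have [h0|h0] := ltP (wall j (word_map (j :: s) base_point)) 0.
  have [t ts tE] := word_map_exchange h0.
  (* The image of [y] is in the closed alcove, while the image of the base point is beyond wall [j];
     hence the image of [y] is on that wall. *)
  have wj : wall j (word_map (j :: s) y) = 0.
    by apply: le_anti; rewrite sy0 wall_word_map_sign.
  have ty : word_map t y = word_map (j :: s) y.
    by rewrite -tE {1}/affine_ref wj scale0r subr0.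
  have [||t' t'0 tt'] := IH t _ y0; first exact: leq_trans ts _.
    by rewrite ty.
  exists (j :: t') => [|z]; last by rewrite -[LHS](affine_refK j) tE tt'.
  by rewrite /= t'0 andbT -wj -ty tt' word_map_fix.
(* Otherwise the tail [s] already crosses wall [j], because the letter [j] flips the sign of
   [wall j]; the exchange then shortens [j :: s] itself. *)
have {}h0 : wall j (word_map s base_point) < 0.
  rewrite lt_neqAle wall_word_map_neq0 /= -oppr_ge0.
  by rewrite -wall_affine_ref_self.
have [t ts tE] := word_map_exchange h0.
have [||t' t'0 tt'] := IH t _ y0.
- exact: ltn_trans ts sm.
- by rewrite -tE.
by exists t' => // z; rewrite -tt' -tE.
Qed.

(** * Finiteness and reduction to the closed alcove *)

Lemma word_lin_finite : finite_set [set f | exists s, f = word_lin s].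
Proof.
apply: (@finite_set_param {ffun 'I_n -> fset_set Phi} 'End(V)
          (fun f h => forall i, h (alpha i) = val (f i))).
  move=> f g h gf hf; apply/lfunP => v.
  rewrite (dual_expand v) !linear_sum /=; apply: eq_bigr => i _.
  by rewrite !linearZZ /= gf hf.
move=> _ [s ->].
have Ps i : word_lin s (alpha i) \in fset_set Phi.
  rewrite in_fset_set ?mem_set //; last exact: root_finite Phi_root.
  exact/word_lin_root/simple_root.
by exists [ffun i => [` Ps i]%fset] => i; rewrite ffunE.
Qed.

Lemma lattice_box_finite (N : nat) :
  finite_set [set mu | lattice mu /\ forall i, `|dot mu (alpha i)| <= N%:R].
Proof.
(* The pairings with simple roots are integers between [-N] and [N]; shifting them by [N] gives
   indices. *)
apply: (@finite_set_param {ffun 'I_n -> 'I_(N + N).+1} V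
          (fun f mu => forall i, dot mu (alpha i) = (f i)%:R - N%:R)).
  move=> f mu nu muf nuf; apply/eqP; rewrite -subr_eq0; apply/eqP.
  by apply: dot_simple_inj => i; rewrite dotBl muf nuf subrr.
move=> mu [Lmu muN].
have muE i : exists2 m, (m < (N + N).+1)%N & dot mu (alpha i) = m%:R - N%:R.
  have /intrP[k kE] := lattice_int Lmu (simple_root i).
  have := muN i; rewrite kE -intr_norm (pmulrn 1 N) ler_int => kN.
  exists (absz (k + N%:Z)); first by lia.
  have -> : (absz (k + N%:Z))%:R = (k + N%:Z)%:~R :> R.
    by rewrite pmulrn; congr (_%:~R); lia.
  by rewrite intrD -pmulrn addrK.
have fP i := svalP (cid2 (muE i)).
exists [ffun i => inord (s2val (cid2 (muE i)))] => i.
by rewrite ffunE inordK; case: cid2.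
Qed.

(** Wall [j] separates [y] from the base point. The squared distance changes by four times the
    product of the two wall values, of opposite signs, over the squared length of [ext j]. *)
Lemma affine_ref_closer j y : wall j y < 0 ->
  dot (affine_ref j y - base_point) (affine_ref j y - base_point) <
  dot (y - base_point) (y - base_point).
Proof.
move=> yj; have p0 := base_wall_gt0 j; set z := y - base_point.
have -> : affine_ref j y - base_point = z - wall j y *: (ext j)^v.
  by rewrite /affine_ref addrAC.
have e0 : 0 < dot (ext j) (ext j) by rewrite dot_gt0 ?ext_neq0.
have ze : dot z (ext j) = wall j y - wall j base_point.
  by rewrite /z dotBl /wall opprD addrACA subrr addr0.
clearbody z; rewrite dotBl !dotBr !dotZl !dotZr (dotC dot (ext j) z) ze.
set N := dot (ext j) (ext j) in e0 *.
rewrite -subr_lt0 [X in X < 0](_ : _ = 4 * (wall j y * wall j base_point) / N).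
  by rewrite pmulr_llt0 ?invr_gt0 // pmulr_rlt0 // nmulr_rlt0.
by field; exact: lt0r_neq0.
Qed.

Lemma near_orbit_finite y : finite_set
  [set z | (exists s, z = word_map s y) /\
           dot (z - base_point) (z - base_point) <=
           dot (y - base_point) (y - base_point)].
Proof.
set r := dot (y - base_point) (y - base_point).
have sqb (t c : R) : t ^+ 2 <= c -> `|t| <= c + 1.
  move=> tc; have [t1|t1] := leP `|t| 1.
    by have := sqr_ge0 t; lra.
  by rewrite -real_normK ?num_real // in tc; nra.
(* The translation part of a nearby [z = w y + mu] is [(z - base_point) + base_point - w y]; the
   three terms bound these pairings with [alpha i], [sqb] replacing square roots in
   Cauchy-Schwarz. *)
pose C i := (r * dot (alpha i) (alpha i) + 1) +
  `|dot base_point (alpha i)| + (dot y y * dot (alpha i) (alpha i) + 1).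
have C0 i : 0 <= C i by rewrite !addr_ge0 ?mulr_ge0 ?dot_ge0.
have CN i : C i <= (Num.bound (\sum_l C l))%:R.
  apply/ltW/le_lt_trans/archi_boundP/sumr_ge0 => //.
  by rewrite (bigD1 i) //= lerDl sumr_ge0.
apply: sub_finite_set (finite_image2 (fun (f : 'End(V)) mu => f y + mu)
  word_lin_finite (lattice_box_finite (Num.bound (\sum_l C l)))).
move=> _ [[s ->] zr]; exists (word_lin s); first by exists s.
exists (word_map s 0); last by rewrite -word_mapE.
split=> [|i]; first exact: lattice_word.
apply: le_trans (CN i).
have -> : word_map s 0 = (word_map s y - base_point) + base_point - word_lin s y.
  by rewrite subrK [in RHS]word_mapE addrAC subrr add0r.
rewrite dotBl dotDl (le_trans (ler_normB _ _)) // lerD //.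
  rewrite (le_trans (ler_normD _ _)) // lerD // sqb //.
  by apply: le_trans (Cauchy_Schwarz _ _ _) _; rewrite ler_wpM2r ?dot_ge0.
by rewrite sqb // -(word_lin_isom s y y); apply: Cauchy_Schwarz.
Qed.

(** The orbit point nearest to the base point is in the closed alcove, by [affine_ref_closer]. *)
Lemma to_closed_alcove y : exists s, closed_alcove (word_map s y).
Proof.
have [|z [[s ->] zr] zmin] := finite_argmin (x := y)
    (fun z => dot (z - base_point) (z - base_point)) (near_orbit_finite y).
  by split=> //; exists [::].
exists s => j; rewrite leNgt; apply/negP => zj; have zc := affine_ref_closer zj.
have /zmin : (exists t, word_map (j :: s) y = word_map t y) /\
    dot (word_map (j :: s) y - base_point) (word_map (j :: s) y - base_point) <=
    dot (y - base_point) (y - base_point).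
  by split; [exists (j :: s)|apply/ltW/(lt_le_trans zc)].
by rewrite leNgt zc.
Qed.

(** * The Weyl group and the lattice translations as words *)

Lemma word_lin_simple i v : word_lin [:: lift ord0 i] v = sref (alpha i) v.
Proof. by rewrite word_lin1 ext_reflE extS. Qed.

Lemma root_coef_eq b i : Phi b -> nonneg_comb alpha b ->
  (forall l, l != i -> dot b (dual l) = 0) -> b = alpha i.
Proof.
move=> Pb b0 bl; have bE : b = dot b (dual i) *: alpha i.
  rewrite {1}(dual_expand b) (bigD1 i) //= big1 ?addr0 // => l /bl ->.
  by rewrite scale0r.
have [|ci|ci] := root_reduced Phi_root (simple_root i) (c := dot b (dual i)).
- by rewrite -bE.
- by rewrite bE ci scale1r.
by have := nonneg_comb_ge0 i b0; rewrite ci oppr_ge0 ler10.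
Qed.

(** The reflection changes only the coefficient of [alpha i], and [b] has another positive
    coefficient, which decides the sign of the image. *)
Lemma simple_refl_pos b i : Phi b -> nonneg_comb alpha b -> b != alpha i ->
  nonneg_comb alpha (sref (alpha i) b).
Proof.
move=> Pb b0 bi; have Pb' := root_reflection Phi_root (simple_root i) Pb.
have [//|Nb] := root_sign Pb'.
case/eqP: bi; apply: root_coef_eq => // l li; apply: le_anti.
rewrite nonneg_comb_ge0 // andbT -oppr_ge0 -dotNl.
have := nonneg_comb_ge0 l Nb; rewrite refl_coroot opprB dotBl /coroot !dotZl.
by rewrite dot_dual eq_sym (negPf li) !mulr0 sub0r dotNl.
Qed.

Lemma root_int b c : Phi b -> Phi c -> dot b c^v \is a Num.int.
Proof. by move=> Pb Pc; apply: (root_crystallographic Phi_root). Qed.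

Lemma coroot_gt0 b v : b != 0 -> (0 < dot v b^v) = (0 < dot v b).
Proof. by move=> b0; rewrite dotZr pmulr_rgt0 // divr_gt0 ?dot_gt0. Qed.

Lemma int_ge1 (x : R) : x \is a Num.int -> 0 < x -> 1 <= x.
Proof. by move=> /intrP[m ->]; rewrite ltr0z ler1z gtz0_ge1. Qed.

(** Simple reflections lower the height of [b] until it is simple. Words without [ord0] lie in the
    group generated by simple reflections and fix the origin. *)
Lemma reflection_word b : Phi b ->
  exists2 s, all (predC1 ord0) s & sref b = word_lin s.
Proof.
move=> Pb; wlog b0 : b Pb / nonneg_comb alpha b.
  by move=> H; have [/(H _ Pb)//|/(H _ (rootN Pb))] := root_sign Pb; rewrite reflN.
have [N] : exists N : nat, \sum_i dot b (dual i) < N%:R.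
  by eexists; apply/archi_boundP/sumr_ge0 => i _; apply: nonneg_comb_ge0.
elim: N b Pb b0 => [|N IH] b Pb b0.
  by rewrite ltNge sumr_ge0 // => i _; apply: nonneg_comb_ge0.
move=> bN; have [i bi] : exists i, 0 < dot b (alpha i).
  apply: contrapT => /forallNP bneg.
  have : dot b b <= 0.
    rewrite {2}(dual_expand b) dot_sumr -oppr_ge0 -sumrN sumr_ge0 // => i _.
    rewrite dotZr -mulrN mulr_ge0 ?nonneg_comb_ge0 // oppr_ge0 leNgt.
    exact/negP.
  by apply/negP; rewrite -ltNge dot_gt0 // (root_neq0 Phi_root).
have [->|nbi] := eqVneq b (alpha i).
  exists [:: lift ord0 i] => //.
  by apply/lfunP => v; rewrite word_lin_simple.
set b' := sref (alpha i) b.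
have Pb' : Phi b' by apply: (root_reflection Phi_root (simple_root i)).
have [|s s0 sE] := IH b' Pb' (simple_refl_pos Pb b0 nbi).
  have m1 : 1 <= dot b (alpha i)^v.
    apply: int_ge1; rewrite ?root_int ?coroot_gt0 ?simple_neq0 //.
    exact: simple_root.
  have -> : \sum_l dot b' (dual l) = \sum_l dot b (dual l) - dot b (alpha i)^v.
    under eq_bigr do rewrite /b' /reflection lfunE /= dotBl dotZl dot_dual.
    rewrite sumrB [X in _ - X](bigD1 i) //= eqxx mulr1.
    rewrite [X in _ - (_ + X)]big1 ?addr0 // => l li.
    by rewrite eq_sym (negPf li) mulr0.
  by move: bN; rewrite -[N.+1]addn1 natrD; lra.
(* The reflection in [b] is the conjugate by the simple reflection [i] of the reflection in [b']. *)
exists (lift ord0 i :: s ++ [:: lift ord0 i]).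
  by rewrite /= all_cat s0.
apply/lfunP => v.
rewrite word_lin_cons word_lin_cat -sE !word_lin_simple ext_reflE extS.
by rewrite -refl_conj /b' ?reflK // => u w; apply: refl_isom.
Qed.

Lemma word_lin_inv s : (word_lin s)^-1%VF = word_lin (rev s).
Proof.
have ker0 : lker (word_lin s) == 0%VS.
  by apply/lker0P; apply: can_inj (word_linK s).
by apply/lfunP => v; rewrite -{1}(word_linVK s v) lker0_lfunK.
Qed.

Lemma weyl_subgroupP J f : weyl_subgroup dot alpha theta J f <->
  exists2 s, all (mem J) s & f = word_lin s.
Proof.
split=> [|[s]].
  elim=> [|_ [j jJ ->]|f1 f2 _ [s sJ ->] _ [t tJ ->]|f1 _ [s sJ ->]].
  - by exists [::].
  - by exists [:: j]; rewrite /= ?jJ //; apply/lfunP => v; rewrite word_lin1.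
  - exists (s ++ t); first by rewrite all_cat sJ.
    by apply/lfunP => v; rewrite word_lin_cat comp_lfunE.
  by exists (rev s); rewrite ?all_rev ?word_lin_inv.
elim: s f => [f _ ->|j s IH f /= /andP[jJ sJ] ->]; first exact: gen_id.
by apply: gen_comp; [apply: gen_base; exists j|apply: IH].
Qed.

(** A word may contain [ord0]; [reflection_word] rewrites the reflection in [theta] by simple
    ones. *)
Lemma weyl_groupP f : weyl_group dot alpha f <-> exists s, f = word_lin s.
Proof.
have simpleW s : all (predC1 ord0) s -> weyl_group dot alpha (word_lin s).
  elim: s => [_|j s IH /= /andP[j0 s0]]; first exact: gen_id.
  apply: gen_comp (IH s0); apply: gen_base; case: (unliftP ord0 j) j0 => [i|] ->.
    by move=> _; exists i; rewrite ext_reflE extS.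
  by rewrite eqxx.
split=> [|[s ->]].
  elim=> [|_ [i ->]|f1 f2 _ [s ->] _ [t ->]|f1 _ [s ->]].
  - by exists [::].
  - by exists [:: lift ord0 i]; apply/lfunP => v; rewrite word_lin_simple.
  - by exists (s ++ t); apply/lfunP => v; rewrite word_lin_cat comp_lfunE.
  by exists (rev s); rewrite word_lin_inv.
elim: s => [|j s IH]; first exact: gen_id.
apply: gen_comp IH; rewrite ext_reflE.
by have [t t0 ->] := reflection_word (ext_rootP j); apply: simpleW.
Qed.

Lemma word_map_simple s : all (predC1 ord0) s -> word_map s 0 = 0.
Proof.
elim: s => //= j s IH /andP[/negPf j0 /IH ->].
by rewrite /affine_ref /wall dot0l !add0r j0 scale0r oppr0.
Qed.

Definition is_translation mu := exists s, forall y, word_map s y = y + mu.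

Lemma is_translationD mu nu :
  is_translation mu -> is_translation nu -> is_translation (mu + nu).
Proof.
move=> [s sE] [t tE]; exists (s ++ t) => y.
by rewrite word_map_cat tE sE -addrA (addrC nu).
Qed.

Lemma is_translationN mu : is_translation mu -> is_translation (- mu).
Proof.
move=> [s sE]; exists (rev s) => y.
by rewrite -{1}(subrK mu y) -sE word_mapK.
Qed.

(** Conjugating a translation by an affine map applies the linear part to its vector. *)
Lemma is_translation_lin s mu :
  is_translation mu -> is_translation (word_lin s mu).
Proof.
move=> [t tE]; exists (s ++ t ++ rev s) => y.
rewrite !word_map_cat tE -[X in _ = X + _](word_mapVK s y).
set z := word_map (rev s) y.
by rewrite word_mapE [in RHS]word_mapE linearD /= addrAC.
Qed.

(** Reflecting in [theta] linearly and then in the parallel affine wall translates by the coroot of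
    [theta]. *)
Lemma is_translation_highest : is_translation theta^v.
Proof.
have [s s0 sE] := reflection_word highest_in; exists (ord0 :: s) => y.
rewrite /= -/(word_map s y) word_mapE word_map_simple // addr0 -sE.
rewrite affine_refE ext_reflE ext0 reflN reflK corootN scale1r opprK.
by [].
Qed.

(** In the finite orbit of [b], a root with the largest pairing with the base point is dominant: a
    negative pairing with [alpha i] would let the reflection [i] increase it. *)
Lemma dominant_conj b : Phi b ->
  exists s, forall i, 0 <= dot (word_lin s b) (alpha i).
Proof.
move=> Pb; have [||c [Pc [s cE]] cmax] := @finite_argmin _ _
    [set c | Phi c /\ exists s, c = word_lin s b] (fun c => - dot base_point c) b.
- by apply: sub_finite_set (root_finite Phi_root) => c [].
- by split=> //; exists [::]; rewrite /= id_lfunE.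
exists s => i; rewrite -cE leNgt; apply/negP => ci.
have /cmax : Phi (sref (alpha i) c) /\
    exists t, sref (alpha i) c = word_lin t b.
  split; first exact: (root_reflection Phi_root (simple_root i)).
  by exists (lift ord0 i :: s); rewrite word_lin_cons ext_reflE extS cE.
rewrite lerN2 refl_coroot dotBr dotZr gerBl leNgt; case/negP.
rewrite nmulr_rlt0 // coroot_gt0 ?simple_neq0 //.
by have := base_wall_gt0 (lift ord0 i); rewrite wallS.
Qed.

(* For a dominant root [b != theta], [dot b theta^v = 1], so that
   [theta^v - b^v] is the image of [theta^v] under the reflection in [b]. *)
Lemma is_translation_coroot b : Phi b -> is_translation b^v.
Proof.
move=> Pb; have [s sdom] := dominant_conj Pb; set c := word_lin s b in sdom.
have Pc : Phi c by apply: word_lin_root.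
suff Tc : is_translation c^v.
  rewrite -(word_linK s b) word_lin_coroot; exact: is_translation_lin.
have [->|cth] := eqVneq c theta; first exact: is_translation_highest.
have th0 := root_neq0 Phi_root highest_in.
have cth_gt0 : 0 < dot c theta^v.
  have thE : dot c theta = \sum_i dot theta (dual i) * dot c (alpha i).
    by rewrite {1}(dual_expand theta) dot_sumr; apply: eq_bigr => i _; rewrite dotZr.
  have term_ge0 i : 0 <= dot theta (dual i) * dot c (alpha i).
    by rewrite mulr_ge0 // (le_trans ler01) // highest_coef_ge1.
  rewrite coroot_gt0 // lt_neqAle thE sumr_ge0 // andbT eq_sym psumr_neq0 //.
  apply/hasP; apply: contrapT => noi.
  have /(root_neq0 Phi_root)/eqP := Pc; apply; apply: dot_simple_inj => i.
  apply/eqP; apply/negPn/negP => ci; case: noi; exists i => //=.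
    exact: mem_index_enum.
  apply: mulr_gt0; first by rewrite (lt_le_trans ltr01) ?highest_coef_ge1.
  by rewrite lt_neqAle eq_sym ci sdom.
have c1 : dot c theta^v = 1.
  have /intrP[m mE] := root_int Pc highest_in.
  move: cth_gt0; rewrite mE ltr0z => m0.
  have [->//|m2] : m = 1 \/ 2 <= m by lia.
  (* If [m >= 2], the root [m theta - c] is bounded by [theta], so the coefficients of [c] are at
     least those of [theta], which forces [c = theta]. *)
  case/eqP: cth; have Pc' := root_reflection Phi_root highest_in Pc.
  rewrite (dual_expand c) [RHS](dual_expand theta).
  apply: eq_bigr => i _; congr (_ *: _); apply: le_anti.
  rewrite le_highest //=.
  have := le_highest i (rootN Pc'); rewrite dotNl /reflection lfunE /=.
  rewrite /reflection_fun dotBl dotZl mE.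
  have m2R : 2 <= m%:~R :> R by rewrite -[2]/(2%:~R) ler_int.
  by have := highest_coef_ge1 i; nra.
have [t _ tE] := reflection_word Pc.
have -> : c^v = theta^v - word_lin t theta^v.
  by rewrite -tE refl_coroot dotC c1 scale1r subKr.
apply: is_translationD is_translation_highest _.
by apply/is_translationN/is_translation_lin/is_translation_highest.
Qed.

Lemma lattice_translation mu : lattice mu -> is_translation mu.
Proof.
apply: lattice_ind; first by exists [::] => y; rewrite addr0.
- exact: is_translationD.
- exact: is_translationN.
- exact: is_translation_coroot.
Qed.

(** Any linear part can be combined with any lattice vector: a translation corrects the translation
    part that [s] already has. *)
Lemma affine_word mu s : lattice mu ->
  exists2 t, word_lin t = word_lin s & forall y, word_map t y = word_lin s y + mu.
Proof.
move=> Lmu; have [|t tE] := @lattice_translation (mu - word_map s 0).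
  exact/latticeD/latticeN/lattice_word.
have mapE y : word_map (t ++ s) y = word_lin s y + mu.
  by rewrite word_map_cat tE word_mapE -addrA [word_map s 0 + _]addrC subrK.
exists (t ++ s) => //; apply/lfunP => v; have := word_map_sub (t ++ s) v 0.
by rewrite !mapE linear0 add0r addrK subr0.
Qed.

(** * Coset representatives and affine descents *)

Local Notation face := (alcove_face dot alpha theta).
Local Notation W := (weyl_group dot alpha).
Local Notation W_ := (weyl_subgroup dot alpha theta).
Local Notation Des := (affine_descents Phi alpha theta).

Lemma eq_word_lin s t : word_map s =1 word_map t -> word_lin s = word_lin t.
Proof.
move=> st; apply/lfunP => v.
by have := word_map_sub s v 0; rewrite !st word_map_sub subr0 => ->.
Qed.

Lemma face_wall_eq0 K x j : face K x -> (wall j x == 0) = (j \in K).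
Proof. by move/alcove_faceP/(_ j); case: ifP => [_ ->|_ /gt_eqF]; rewrite ?eqxx. Qed.

Lemma face_strict s K x : face K x -> closed_alcove (word_map s x) ->
  word_map s x = x /\ W_ K (word_lin s).
Proof.
move=> xK sx; have [t t0 st] := closed_alcove_strict (alcove_face_closed xK) sx.
split; first by rewrite st word_map_fix.
apply/weyl_subgroupP; exists t; last exact: eq_word_lin.
by apply/allP => j /(allP t0); rewrite (face_wall_eq0 _ xK).
Qed.

Lemma neg_rootP b : Phi b ->
  neg_root Phi alpha b <-> dot base_point b < 0.
Proof.
have ge0 c : nonneg_comb alpha c -> 0 <= dot base_point c.
  move=> c0; rewrite (dual_expand c) -sum_wallS sumr_ge0 // => i _.
  by rewrite mulr_ge0 ?nonneg_comb_ge0 // ltW // base_wall_gt0.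
move=> Pb; split=> [[_ /ge0]|b0].
  rewrite dotNr oppr_ge0 lt_neqAle => ->.
  by have := root_base_neq0 0 Pb; rewrite addr0 andbT.
split=> //; have [/ge0|//] := root_sign Pb.
by rewrite leNgt b0.
Qed.

Lemma word_lin_posP s j :
  (j \notin Des (word_lin s)) = (0 < dot base_point (word_lin s (ext j))).
Proof.
have Pb := word_lin_root s (ext_rootP j).
rewrite inE lt_neqAle eq_sym -[X in X != 0]addr0 (root_base_neq0 0) //=.
rewrite leNgt; congr (~~ _).
by apply/asboolP/idP => /(neg_rootP Pb).
Qed.

(** The vector [q] lies in the open chamber cut out by the roots of [K]. The representative [w] of
    the coset that maximizes the pairing of the base point with [w q] has no descent in [K]. *)
Lemma coset_rep K s : K != [set: 'I_n.+1]%SET ->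
  exists2 r, all (mem K) r & Des (word_lin (s ++ r)) \subset ~: K.
Proof.
move=> /alcove_face_nonempty[x xK]; pose q := base_point - x.
have q_gt0 j : j \in K -> 0 < dot q (ext j).
  move=> jK; have := face_wall_eq0 j xK; rewrite jK => /eqP xj.
  have -> : dot q (ext j) = wall j base_point - wall j x.
    by rewrite /q dotBl /wall opprD addrACA subrr addr0.
  by rewrite xj subr0 base_wall_gt0.
have [||f [r rK fE] fmax] := @finite_argmin _ _
    [set f | exists2 r, all (mem K) r & f = word_lin (s ++ r)]
    (fun f => - dot base_point (f q)) (word_lin (s ++ [::])).
- by apply: sub_finite_set word_lin_finite => f [r _ ->]; exists (s ++ r).
- by exists [::].
exists r => //; apply/fintype.subsetP => j; apply: contraLR.
rewrite inE negbK => jK; rewrite word_lin_posP.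
(* Maximality is tested against [w] followed on the right by the reflection [j], which subtracts a
   positive multiple of the coroot of [w (ext j)]. *)
have /fmax : exists2 t, all (mem K) t &
    word_lin (s ++ rcons r j) = word_lin (s ++ t).
  by exists (rcons r j) => //; rewrite all_rcons rK andbT.
rewrite fE -cats1 catA lerN2 [word_lin ((s ++ r) ++ _) q]word_lin_cat word_lin1.
rewrite ext_reflE refl_coroot linearB linearZZ /= -word_lin_coroot.
rewrite dotBr dotZr gerBl pmulr_rge0 ?q_gt0 // le_eqVlt => /orP[/eqP/esym h|].
  have := root_base_neq0 0 (word_lin_root (s ++ r) (ext_rootP j)).
  have n0 := root_neq0 Phi_root (word_lin_root (s ++ r) (ext_rootP j)).
  move: h => /eqP; rewrite dotZr addr0 mulf_eq0 => /orP[|->//].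
  by rewrite gt_eqF // divr_gt0 // dot_gt0.
by rewrite coroot_gt0 // (root_neq0 Phi_root) //; apply/word_lin_root/ext_rootP.
Qed.

(* Both translates of [x] below lie in the open alcove and are exchanged by the
   affine extension of [word_lin r] fixing [x]. *)
Lemma coset_rep_unique K s r : K != [set: 'I_n.+1]%SET -> all (mem K) r ->
  Des (word_lin s) \subset ~: K -> Des (word_lin (s ++ r)) \subset ~: K ->
  word_lin r = \1%VF.
Proof.
move=> /alcove_face_nonempty[x xK] rK sK srK.
pose p1 := word_lin (rev s) base_point; pose p2 := word_lin (rev r) p1.
have pos t j : Des (word_lin t) \subset ~: K -> j \in K ->
    0 < dot (word_lin (rev t) base_point) (ext j).
  move=> /fintype.subsetP tK jK; rewrite dot_word_lin revK -word_lin_posP.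
  by apply/negP => /tK; rewrite inE jK.
have p1_gt0 j : j \in K -> 0 < dot p1 (ext j) by apply: pos.
have p2_gt0 j : j \in K -> 0 < dot p2 (ext j).
  by move=> jK; rewrite /p2 /p1 -word_lin_cat -rev_cat pos.
have near p : (forall j, j \in K -> 0 < dot p (ext j)) -> exists2 e, 0 < e &
    forall d, 0 < d -> d <= e -> face finset.set0 (x + d *: p).
  move=> p0; have [|j _ /eqP|e e0 eP] := @small_perturbation _ _
      (enum 'I_n.+1) (wall^~ x) (fun j => dot p (ext j)).
  - by move=> j _; apply: alcove_face_closed xK j.
  - by rewrite (face_wall_eq0 _ xK); apply: p0.
  exists e => // d d0 de; apply/alcove_faceP => j; rewrite inE.
  by rewrite /wall dotDl dotZl addrAC; apply: eP => //; rewrite mem_enum.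
have [e1 e10 e1P] := near p1 p1_gt0; have [e2 e20 e2P] := near p2 p2_gt0.
pose e := Num.min e1 e2; have e0 : 0 < e by rewrite lt_min e10.
have f1 : face finset.set0 (x + e *: p1) by apply: e1P; rewrite // ge_min lexx.
have f2 : face finset.set0 (x + e *: p2).
  by apply: e2P; rewrite // ge_min lexx orbT.
have rx : word_map (rev r) x = x.
  apply: word_map_fix; rewrite all_rev; apply: sub_all rK => j.
  by rewrite (face_wall_eq0 _ xK).
have rE : word_map (rev r) (x + e *: p1) = x + e *: p2.
  by rewrite word_mapE linearD linearZZ /= addrAC -word_mapE rx.
have [|_ /weyl_subgroupP[t t0 tE]] := face_strict (s := rev r) f1.
  by rewrite rE; apply: alcove_face_closed f2.
have t_nil : t = [::] by case: t t0 {tE} => //= j t; rewrite inE.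
by apply/lfunP => v; have := word_linK r v; rewrite tE t_nil /= !id_lfunE.
Qed.

(** The linear parts of the walls satisfy a relation with positive coefficients, so the images of
    the extended roots cannot all be positive. *)
Lemma Des_neq0 s : Des (word_lin s) != finset.set0.
Proof.
apply/eqP => D0; have := sum_mark_wall 0.
(* Subtracting the relation at 0 removes its constant terms. *)
have := sum_mark_wall (word_lin (rev s) base_point).
have -> : \sum_j mark j * wall j (word_lin (rev s) base_point) =
    \sum_j mark j * dot base_point (word_lin s (ext j)) + \sum_j mark j * wall j 0.
  rewrite -big_split /=; apply: eq_bigr => j _.
  by rewrite /wall dot0l add0r dot_word_lin revK mulrDr.
move=> + h; rewrite h => /eqP; rewrite -subr_eq0 addrK psumr_eq0 => [|j _].
  move/allP/(_ ord0 (mem_index_enum _)) => /=.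
  rewrite mulf_eq0 (gt_eqF (mark_gt0 _)) /=.
  by rewrite gt_eqF // -word_lin_posP D0 inE.
by rewrite mulr_ge0 ?(ltW (mark_gt0 _)) // ltW // -word_lin_posP D0 inE.
Qed.

(** * Cells of the affine Coxeter complex, closures and colors *)

Local Notation cell s K := [set word_map s x | x in face K].

Lemma open_cell_word s x :
  open_cell dot Phi (word_map s x) = [set word_map s y | y in open_cell dot Phi x].
Proof.
have sub t z y : open_cell dot Phi z y ->
    open_cell dot Phi (word_map t z) (word_map t y).
  move=> zy b k Pb; have [k' kE] := dot_word_mapE t (- k) Pb.
  have := zy _ (- k') (word_lin_root (rev t) Pb).
  by rewrite !rmorphN /= !opprK -!kE rmorphN.
apply/seteqP; split=> [y xy|_ [y xy <-]]; last exact: sub.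
exists (word_map (rev s) y); last exact: word_mapVK.
by rewrite -(word_mapK s x); apply: sub.
Qed.

Lemma open_cell_face K x : face K x -> open_cell dot Phi x = face K.
Proof.
move=> xK; apply/seteqP; split=> [y xy|y yK b k Pb].
  apply/alcove_faceP => j; have := xy (ext j) (- (j == ord0)%:Z) (ext_rootP j).
  rewrite !rmorphN /= !opprK -pmulrn -!/(wall j _).
  move/alcove_faceP/(_ j): xK; case: ifP => _.
    by move=> ->; rewrite sgr0 => /eqP; rewrite sgr_eq0 => /eqP.
  by move=> /gtr0_sg -> /eqP; rewrite sgr_cp0.
by have := root_face_sg (- k) Pb yK xK; rewrite !rmorphN.
Qed.

Lemma open_cell_wordP x : exists s K,
  K != [set: 'I_n.+1]%SET /\ open_cell dot Phi x = cell s K.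
Proof.
have [s sx] := to_closed_alcove x; have xK := alcove_face_walls sx.
exists (rev s); eexists; split; last first.
  by rewrite -{1}(word_mapK s x) open_cell_word (open_cell_face xK).
by apply/eqP => KT; rewrite KT in xK; apply: full_face_empty xK.
Qed.

Lemma cell_open s K : K != [set: 'I_n.+1]%SET ->
  exists x, cell s K = open_cell dot Phi x.
Proof.
move=> /alcove_face_nonempty[x xK]; exists (word_map s x).
by rewrite open_cell_word (open_cell_face xK).
Qed.

(** Walls are Lipschitz by Cauchy-Schwarz. The tolerance [wall j y ^+ 2] forces nearby wall values
    to have the sign of [wall j y]. *)
Lemma closure_face K y : euclidean_closure dot (face K) y ->
  closed_alcove y /\ forall j, j \in K -> wall j y = 0.
Proof.
have close j c : euclidean_closure dot (face K) y -> 0 < c ->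
    exists2 z, face K z & (wall j y - wall j z) ^+ 2 < c.
  move=> Ky c0; have e0 : 0 < dot (ext j) (ext j) by rewrite dot_gt0 ?ext_neq0.
  have [|z zK zy] := Ky (c / dot (ext j) (ext j)); first exact: divr_gt0.
  exists z => //; rewrite ltr_pdivlMr // in zy; apply: le_lt_trans zy.
  have -> : wall j y - wall j z = dot (y - z) (ext j).
    by rewrite dotBl /wall opprD addrACA subrr addr0.
  exact: Cauchy_Schwarz.
move=> Ky; split=> j => [|jK].
  rewrite leNgt; apply/negP => yj.
  have [|z /alcove_face_closed/(_ j) zj] := close j (wall j y ^+ 2) Ky.
    by rewrite exprn_even_gt0 //= lt_eqF.
  by nra.
apply/eqP/negPn/negP => yj.
have [|z zK] := close j (wall j y ^+ 2) Ky; first by rewrite exprn_even_gt0.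
have /eqP -> : wall j z == 0 by rewrite (face_wall_eq0 _ zK).
by rewrite subr0 ltxx.
Qed.

Lemma vertex_closure j K x : K != [set: 'I_n.+1]%SET -> j \notin K ->
  face (~: [set j])%SET x -> euclidean_closure dot (face K) x.
Proof.
move=> /alcove_face_nonempty[z zK] jK xj e e0; pose D := dot (x - z) (x - z).
have D0 : 0 <= D by apply: dot_ge0.
have s0 : 0 < e + D + 1 by rewrite addr_gt0 // ltr_pwDl.
(* The step along the segment from the vertex [x] to [z] is between 0 and 1 and satisfies
   [t ^+ 2 * D < e]. *)
pose t := e / (e + D + 1); have t0 : 0 < t by apply: divr_gt0.
have tE : t * (e + D + 1) = e by rewrite /t divfK // gt_eqF.
have t1 : t < 1 by rewrite ltr_pdivrMr // mul1r; lra.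
exists (x + t *: (z - x)).
  apply/alcove_faceP => i.
  have -> : wall i (x + t *: (z - x)) = (1 - t) * wall i x + t * wall i z.
    by rewrite /wall dotDl dotZl dotBl; ring.
  have xi := alcove_face_closed xj i; move/alcove_faceP/(_ i): zK.
  case: ifP => iK zi; last by nra.
  have /eqP -> : wall i x == 0.
    by rewrite (face_wall_eq0 _ xj) !inE; apply: contraTN iK => /eqP ->.
  by rewrite zi !mulr0 addr0.
have -> : x - (x + t *: (z - x)) = t *: (x - z).
  by rewrite opprD addrA subrr add0r -scalerN opprB.
rewrite dotZl dotZr -/D; nra.
Qed.

Lemma vertex_notin_full j : (~: [set j])%SET != [set: 'I_n.+1]%SET.
Proof. by apply/eqP => /setP/(_ j); rewrite !inE eqxx. Qed.

Lemma closure_word s F x : euclidean_closure dot [set word_map s y | y in F] x <->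
  euclidean_closure dot F (word_map (rev s) x).
Proof.
have dotE y : dot (x - word_map s y) (x - word_map s y) =
    dot (word_map (rev s) x - y) (word_map (rev s) x - y).
  by rewrite -{1 2}(word_mapVK s x) word_map_sub word_lin_isom.
split=> Fx e /Fx.
  by move=> [z [y Fy <-]]; rewrite dotE => ?; exists y.
by move=> [y Fy]; rewrite -dotE => ?; exists (word_map s y) => //; exists y.
Qed.

Lemma translated_cellP s K mu : lattice mu -> exists2 t,
  word_lin t = word_lin s & [set mu + x | x in cell s K] = cell t K.
Proof.
move=> Lmu; have [|t ts tE] := @affine_word (mu + word_map s 0) s.
  exact/latticeD/lattice_word.
have mapE y : word_map t y = mu + word_map s y.
  by rewrite tE [in RHS]word_mapE addrCA.
exists t => //; apply/seteqP; split=> u [y].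
  by move=> [z zK <-] <-; exists z; rewrite ?mapE.
by move=> yK <-; exists (word_map s y); rewrite ?mapE //; exists y.
Qed.

Lemma linear_cellP s K mu : lattice mu -> exists2 t,
  word_lin t = word_lin s & [set mu + word_lin s x | x in face K] = cell t K.
Proof.
move=> Lmu; have [t ts tE] := affine_word s Lmu.
exists t => //; apply/seteqP.
by split=> _ [y yK <-]; exists y; rewrite // tE addrC.
Qed.

Lemma cell_colorsE s K : K != [set: 'I_n.+1]%SET ->
  cell_colors dot Phi alpha theta (cell s K) = (~: K)%SET.
Proof.
move=> KT; apply/setP => j; rewrite !inE; apply/asboolP/idP => [[v]|jK].
  move=> [mu [_ [Lmu /weyl_groupP[s1 ->] ->]]].
  have [t _ ->] := linear_cellP s1 (~: [set j])%SET Lmu => sub.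
  have [x xj] := alcove_face_nonempty (vertex_notin_full j).
  (* By strictness, the translate of the vertex [x] found in the closed alcove is [x] itself, and
     [wall j] does not vanish there. *)
  have /closure_word/closure_face[u0 uK] := sub _ (ex_intro2 _ _ x xj erefl).
  rewrite -word_map_cat in u0 uK; have [ux _] := face_strict xj u0.
  apply/negP => /uK; rewrite ux => /eqP.
  by rewrite (face_wall_eq0 _ xj) !inE eqxx.
exists (cell s (~: [set j])%SET).
  exists (word_map s 0), (word_lin s); split; first exact: lattice_word.
    by apply/weyl_groupP; exists s.
  by congr image; apply/funext => x; rewrite [LHS]word_mapE addrC.
move=> _ [x xj <-]; apply/closure_word; rewrite word_mapK.
exact: vertex_closure xj.
Qed.

(** * Cells of the Steinberg torus *)

Local Notation orbit := (lattice_orbit dot Phi).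

Lemma mem_orbit F : orbit F F.
Proof.
exists 0; first exact: lattice0.
apply/seteqP; split=> x; first by move=> Fx; exists x; rewrite ?add0r.
by move=> [y Fy <-]; rewrite add0r.
Qed.

Lemma orbit_translate mu F : lattice mu -> orbit [set mu + x | x in F] = orbit F.
Proof.
move=> Lmu; have shift nu nu' : [set nu + x | x in [set nu' + x | x in F]] =
    [set nu + nu' + x | x in F].
  apply/seteqP; split=> u [x].
    by move=> [y Fy <-] <-; exists y; rewrite ?addrA.
  by move=> Fx <-; exists (nu' + x); rewrite ?addrA //; exists x.
apply/seteqP; split=> _ [nu Lnu ->].
  by exists (nu + mu); rewrite ?shift //; apply: latticeD.
exists (nu - mu); first exact/latticeD/latticeN.
by rewrite shift subrK.
Qed.

Lemma orbit_colorsE s K : K != [set: 'I_n.+1]%SET ->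
  orbit_colors dot Phi alpha theta (orbit (cell s K)) = (~: K)%SET.
Proof.
move=> KT; apply/setP => j; rewrite inE; apply/asboolP/idP.
  move=> [_ [mu Lmu ->]]; have [t _ ->] := translated_cellP s K Lmu.
  by rewrite cell_colorsE.
by move=> jK; exists (cell s K); [apply: mem_orbit|rewrite cell_colorsE].
Qed.

(** Translations disappear in the orbit, so a cell of the torus is indexed by a linear part
    alone. *)
Definition face_orbit K (w : 'End(V)) := orbit [set w x | x in face K].

Lemma face_orbit_word K s : face_orbit K (word_lin s) = orbit (cell s K).
Proof.
rewrite /face_orbit -(orbit_translate [set word_lin s x | x in face K] (lattice_word s)).
congr orbit; apply/seteqP; split=> u.
  by move=> [_ [y yK <-] <-]; exists y; rewrite // word_mapE addrC.
move=> [y yK <-]; exists (word_lin s y); first by exists y.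
by rewrite [RHS]word_mapE addrC.
Qed.

Lemma face_orbit_coset K s r : all (mem K) r ->
  face_orbit K (word_lin (s ++ r)) = face_orbit K (word_lin s).
Proof.
move=> rK; rewrite !face_orbit_word; congr orbit.
have rx x : face K x -> word_map r x = x.
  move=> xK; apply: word_map_fix; apply: sub_all rK => j.
  by rewrite (face_wall_eq0 _ xK).
by apply/seteqP; split=> _ [x xK <-]; exists x; rewrite // word_map_cat rx.
Qed.

(** Equal orbits give a word that carries a point of the face back into the closed alcove;
    strictness puts its linear part in [W_K]. *)
Lemma face_orbit_inj K s t : K != [set: 'I_n.+1]%SET ->
  face_orbit K (word_lin s) = face_orbit K (word_lin t) ->
  exists2 r, all (mem K) r & word_lin t = word_lin (s ++ r).
Proof.
rewrite !face_orbit_word => /alcove_face_nonempty[x xK] st.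
have := mem_orbit (cell t K); rewrite -st => -[mu Lmu].
have [s' ss' ->] := translated_cellP s K Lmu => tE.
have : cell t K (word_map t x) by exists x.
rewrite tE => -[y yK yx].
have xy : word_map (rev s' ++ t) x = y by rewrite word_map_cat -yx word_mapK.
have [|_ /weyl_subgroupP[r rK rE]] := face_strict (s := rev s' ++ t) xK.
  by rewrite xy; apply: alcove_face_closed yK.
exists r => //; apply/lfunP => v.
by rewrite word_lin_cat -rE word_lin_cat -ss' word_linVK.
Qed.

Lemma steinberg_cells O :
  @cells n (reduced_steinberg_torus dot Phi alpha theta) O <->
  exists s K, K != [set: 'I_n.+1]%SET /\ O = face_orbit K (word_lin s).
Proof.
have orbit0 x : orbit (open_cell dot Phi x) <> orbit set0.
  move=> x0; have := mem_orbit (open_cell dot Phi x); rewrite x0 => -[mu _].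
  rewrite image_set0 => x00.
  have xx : open_cell dot Phi x x by [].
  by rewrite x00 in xx.
split=> [[[F [->|[x ->]] ->]] nO|[s [K [KT ->]]]].
- by case: nO.
- have [s [K [KT xE]]] := open_cell_wordP x.
  by exists s, K; rewrite face_orbit_word xE.
have [x xE] := cell_open s KT; rewrite face_orbit_word xE.
split; last exact: orbit0.
by exists (open_cell dot Phi x) => //; right; exists x.
Qed.

Lemma steinberg_color_set s K : K != [set: 'I_n.+1]%SET ->
  @color_set n (reduced_steinberg_torus dot Phi alpha theta)
    (face_orbit K (word_lin s)) = (~: K)%SET.
Proof. by move=> KT; rewrite /= face_orbit_word orbit_colorsE. Qed.

(** * Counting cells and cosets *)

Lemma weyl_finite : finite_set W.
Proof.
by apply: sub_finite_set word_lin_finite => f /weyl_groupP.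
Qed.

Lemma weyl_subgroup_sub J : W_ J `<=` W.
Proof. by move=> f /weyl_subgroupP[s _ ->]; apply/weyl_groupP; exists s. Qed.

Lemma compl_neqT J : J != finset.set0 -> (~: J)%SET != [set: 'I_n.+1]%SET.
Proof.
by apply: contra_neq => JT; rewrite -(finset.setCK J) JT finset.setCT.
Qed.

Lemma coset_rep_compl J s : J != finset.set0 ->
  exists2 r, all (mem (~: J)%SET) r & Des (word_lin (s ++ r)) \subset J.
Proof.
move=> J0; have [r rJ] := coset_rep s (compl_neqT J0).
by rewrite finset.setCK; exists r.
Qed.

Lemma coset_rep_compl_unique J s r : J != finset.set0 -> all (mem (~: J)%SET) r ->
  Des (word_lin s) \subset J -> Des (word_lin (s ++ r)) \subset J ->
  word_lin r = \1%VF.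
Proof.
move=> J0 rJ sJ srJ; apply: (coset_rep_unique (K := (~: J)%SET)) rJ _ _.
- exact: compl_neqT.
- by rewrite finset.setCK; apply: sJ.
- by rewrite finset.setCK.
Qed.

Local Notation T := (reduced_steinberg_torus dot Phi alpha theta).

(** The map [face_orbit (~: J)] is a bijection from these [w] onto the cells of color-set [J]. For
    empty [J] both sides are empty, by deletion of the empty cell and by [Des_neq0]. *)
Lemma flag_f_descents J : flag_f T J = fincard [set w | W w /\ Des w \subset J].
Proof.
have KT : (~: J)%SET != [set: 'I_n.+1]%SET \/ J = finset.set0.
  by have [->|/compl_neqT] := eqVneq J finset.set0; [right|left].
rewrite -(@fincard_image _ _ [set w | W w /\ Des w \subset J] (face_orbit (~: J))).
- congr fincard; apply/seteqP; split=> O.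
    move=> [/steinberg_cells[s [K [KT' ->]]]].
    rewrite steinberg_color_set // => KJ; rewrite -KJ finset.setCK.
    have J0 : J != finset.set0.
      rewrite -KJ; apply: contra_neq KT' => K0.
      by rewrite -(finset.setCK K) K0 finset.setC0.
    have [r] := coset_rep_compl s J0; rewrite -KJ finset.setCK => rK srJ.
    exists (word_lin (s ++ r)); last exact: face_orbit_coset.
    by split=> //; apply/weyl_groupP; exists (s ++ r).
  move=> [w [/weyl_groupP[s ->] sJ] <-].
  have KT' : (~: J)%SET != [set: 'I_n.+1]%SET.
    case: KT => // J0; move: sJ; rewrite J0 finset.subset0.
    by rewrite (negPf (Des_neq0 s)).
  split; first by apply/steinberg_cells; exists s, (~: J)%SET.
  by rewrite steinberg_color_set // finset.setCK.
- by apply: sub_finite_set weyl_finite => w [].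
move=> _ _ [/weyl_groupP[s ->] sJ] [/weyl_groupP[t ->] tJ].
have J0 : J != finset.set0.
  by apply: contraTneq sJ => ->; rewrite finset.subset0 Des_neq0.
have KT' : (~: J)%SET != [set: 'I_n.+1]%SET.
  by case: KT => // /eqP; rewrite (negPf J0).
move=> /(face_orbit_inj KT')[r rJ tE]; rewrite tE in tJ *.
have r1 := coset_rep_compl_unique J0 rJ sJ tJ.
by apply/lfunP => v; rewrite word_lin_cat r1 id_lfunE.
Qed.

(** Composition is a bijection from pairs of a coset representative and an element of the subgroup
    onto W. *)
Lemma weyl_subgroup_index J : J != finset.set0 ->
  fincard W =
    (fincard [set w | W w /\ Des w \subset J] * fincard (W_ (~: J)))%N.
Proof.
move=> J0.
have Jfin : finite_set [set w | W w /\ Des w \subset J].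
  by apply: sub_finite_set weyl_finite => w [].
have WJfin : finite_set (W_ (~: J)).
  exact: sub_finite_set (@weyl_subgroup_sub _) weyl_finite.
rewrite -fincardX // -(@fincard_image _ _ _ (fun p => (p.1 \o p.2)%VF)).
- congr fincard; apply/seteqP; split=> [_ /weyl_groupP[s ->]|].
    have [r rJ srJ] := coset_rep_compl s J0.
    exists (word_lin (s ++ r), word_lin (rev r)); last first.
      apply/lfunP => v /=.
      by rewrite comp_lfunE word_lin_cat word_linVK.
    split=> /=; first by split=> //; apply/weyl_groupP; exists (s ++ r).
    by apply/weyl_subgroupP; exists (rev r); rewrite ?all_rev.
  move=> _ [[w u] /= [[/weyl_groupP[s ->] _] /weyl_subgroupP[r _ ->]] <-].
  apply/weyl_groupP; exists (s ++ r).
  by apply/lfunP => v; rewrite comp_lfunE word_lin_cat.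
- exact: finite_setX.
move=> [w1 u1] [w2 u2] /= [[/weyl_groupP[s ->] sJ] /weyl_subgroupP[r rJ ->]].
move=> [[/weyl_groupP[t ->] tJ] /weyl_subgroupP[q qJ ->]] /lfunP st.
have tE : word_lin t = word_lin (s ++ (r ++ rev q)).
  apply/lfunP => v; have := st (word_lin (rev q) v).
  by rewrite !comp_lfunE word_linVK !word_lin_cat.
have rq1 : word_lin (r ++ rev q) = \1%VF.
  apply: (coset_rep_compl_unique J0 _ sJ); first by rewrite all_cat rJ all_rev.
  by rewrite -tE.
have ts : word_lin t = word_lin s.
  by rewrite tE; apply/lfunP => v; rewrite word_lin_cat rq1 id_lfunE.
rewrite ts; congr pair; apply/lfunP => v; have := st v.
by rewrite !comp_lfunE ts => /(can_inj (word_linK s)).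
Qed.

Local Notation weyl_seq := (enum_fset (fset_set W)).

Lemma fincard_weyl (P : pred {set 'I_n.+1}) :
  fincard [set w | W w /\ P (Des w)] = (\sum_(w <- weyl_seq) P (Des w))%N.
Proof.
rewrite -big_mkcond /= sum1_count -size_filter.
apply: fincardE => [|w]; first by rewrite filter_uniq // fset_uniq.
rewrite mem_filter in_fset_set; last exact: weyl_finite.
split=> [[Ww Pw]|/andP[Pw /set_mem]]; last by split.
by apply/andP; split=> //; apply: mem_set.
Qed.

End AffineWeylGroup.

Theorem theorem3p1 (R : realType) (V : vectType R) (dot : {dot V for idfun})
    (n : nat) (Phi : set V) (alpha : 'I_n -> V) (theta : V)
    (Phi_root : root_system dot Phi)
    (Phi_irr : irreducible_system dot Phi)
    (alpha_simple : simple_roots Phi alpha)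
    (theta_highest : highest_root Phi alpha theta) :
  let W := weyl_group dot alpha in
  let Des := affine_descents Phi alpha theta in
  let T := reduced_steinberg_torus dot Phi alpha theta in
  [/\ flag_h_poly T = affine_eulerian dot Phi alpha theta,
      forall J : {set 'I_n.+1},
        flag_f T J = fincard [set w | W w /\ Des w \subset J],
      forall J : {set 'I_n.+1},
        flag_h T J = (fincard [set w | W w /\ Des w = J])%:Z &
      affine_eulerian dot Phi alpha theta =
      \sum_(J : {set 'I_n.+1} | J \proper [set: 'I_n.+1]%SET)
        ((fincard W)%:R / (fincard (weyl_subgroup dot alpha theta J))%:R) *:
        (\prod_(j in J) (1 - 'X_j) * \prod_(j in ~: J) 'X_j)].
Proof.
move=> W Des T.
have flag_fE J : flag_f T J = fincard [set w | W w /\ Des w \subset J].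
  exact: (flag_f_descents Phi_root alpha_simple theta_highest).
have Wfin : finite_set W := weyl_finite Phi_root alpha_simple theta_highest.
pose ws := enum_fset (fset_set W).
have cardW (P : pred {set 'I_n.+1}) :
    fincard [set w | W w /\ P (Des w)] = (\sum_(w <- ws) P (Des w))%N.
  exact: (fincard_weyl Phi_root alpha_simple theta_highest).
have cardW_eq J : fincard [set w | W w /\ Des w = J] =
    (\sum_(w <- ws) (Des w == J))%N.
  rewrite -(cardW (pred1 J)); congr fincard.
  by apply/seteqP; split=> w [Ww /eqP].
have flag_hE J : flag_h T J = (fincard [set w | W w /\ Des w = J])%:Z.
  rewrite cardW_eq -natz natr_sum /flag_h.
  under [LHS]eq_bigr => I _.
    rewrite flag_fE (cardW (fun D => D \subset I)) -natz natr_sum mulr_sumr.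
    over.
  (* Each [w] is counted separately, by inclusion-exclusion between its descent set and [J]. *)
  rewrite exchange_big; apply: eq_bigr => w _.
  rewrite -inclusion_exclusion big_mkcondr; apply: eq_bigr => I _.
  by case: (_ \subset I); rewrite ?mulr1 ?mulr0.
have eulerE : affine_eulerian dot Phi alpha theta =
    \sum_(w <- ws) \prod_(j in Des w) 'X_j.
  by rewrite /affine_eulerian fsbig_finite.
split=> //.
  rewrite eulerE /flag_h_poly.
  under [LHS]eq_bigr => J _.
    rewrite flag_hE cardW_eq -pmulrn natr_sum scaler_suml.
    over.
  rewrite exchange_big; apply: eq_bigr => w _.
  rewrite (bigD1 (Des w)) //= eqxx scale1r [X in _ + X]big1 ?addr0 // => J.
  by rewrite eq_sym => /negPf ->; rewrite scale0r.
rewrite eulerE; pose F (J : {set 'I_n.+1}) : {mpoly rat[n.+1]} :=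
  \prod_(j in J) (1 - 'X_j) * \prod_(j in ~: J) 'X_j.
(* The quotient of the two orders is the number of [w] with [Des w \subset ~: J], by
   [weyl_subgroup_index]. *)
transitivity (\sum_(J : {set 'I_n.+1})
    (\sum_(w <- ws) (Des w \subset ~: J))%N%:R *: F J).
  under [RHS]eq_bigr => J _ do rewrite natr_sum scaler_suml.
  rewrite exchange_big; apply: eq_bigr => w _ /=.
  (* The monomial of [w] is multiplied by the expansion of the product of ['X_j + (1 - 'X_j)] over
     the other indices. *)
  transitivity (\sum_(J : {set 'I_n.+1} | Des w \subset J)
      (\prod_(j in J) 'X_j * \prod_(j in ~: J) (1 - 'X_j)) : {mpoly rat[n.+1]}).
    rewrite sum_supersets [X in _ * X]big1 ?mulr1 // => j _.
    by rewrite addrC subrK.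
  rewrite (reindex_inj (@finset.setC_inj _)) big_mkcond /=; apply: eq_bigr => J _.
  rewrite finset.setCK /F mulrC.
  by case: (_ \subset _); rewrite ?scale1r ?scale0r.
(* The full set contributes nothing, since no [w] has an empty descent set. *)
rewrite (bigID (fun J : {set 'I_n.+1} => J \proper [set: 'I_n.+1]%SET)) /=.
rewrite [X in _ + X]big1 ?addr0 => [|J]; last first.
  rewrite properT negbK => /eqP ->; rewrite finset.setCT.
  rewrite big1_seq ?scale0r // => w; rewrite in_fset_set // => /andP[_ /set_mem].
  move/(weyl_groupP Phi_root alpha_simple theta_highest) => [s ->].
  by rewrite finset.subset0 (negPf (Des_neq0 Phi_root alpha_simple theta_highest s)).
apply: eq_bigr => J JT; congr (_ *: _).
have J0 : (~: J)%SET != finset.set0.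
  apply: contraTneq JT => JC.
  by rewrite properT -(finset.setCK J) JC finset.setC0 eqxx.
have := weyl_subgroup_index Phi_root alpha_simple theta_highest J0.
rewrite finset.setCK (cardW (fun D => D \subset ~: J)) => ->.
have id_in : weyl_subgroup dot alpha theta J \1%VF by apply: gen_id.
have WJ0 : (0 < fincard (weyl_subgroup dot alpha theta J))%N.
  apply: fincard_gt0 id_in; apply: sub_finite_set Wfin.
  exact: (weyl_subgroup_sub Phi_root alpha_simple theta_highest).
by rewrite natrM mulfK // pnatr_eq0 -lt0n.
Qed.
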